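(* Let $C$ be a tilted algebra, let $E=\operatorname{Ext}^2_C(DC,C)$, and let $B=C\ltimes E$ be the corresponding cluster-tilted algebra. Let $M$ be an indecomposable $\tau_C$-rigid $C$-module. Then $M$, viewed as a $B$-module, is $\tau_B$-rigid if and only if $\operatorname{Hom}_C(\tau_C^{-1}\Omega_C^{-1}M,\operatorname{Gen}M)=0$.
   Context: All algebras are finite dimensional over an algebraically closed field $k$, and all modules are finitely generated right modules. A tilted algebra is an algebra of the form $\operatorname{End}_A T$, where $A$ is a hereditary algebra and $T$ is a tilting $A$-module, i.e. $\operatorname{pd}_A T\le 1$, $\operatorname{Ext}^1_A(T,T)=0$, and there is a short exact sequence $0\to A\to T'\to T''\to 0$ with $T',T''\in\operatorname{add}T$, where $\operatorname{add} T$ is the class of direct sums of direct summands of $T$. $D=\operatorname{Hom}_k(-,k)$ is the standard duality, and $E=\operatorname{Ext}^2_C(DC,C)$ has its natural $C$-$C$-bimodule structure. $C\ltimes E$ is the trivial extension: the vector space $C\oplus E$ with multiplication $(c,e)(c',e')=(cc',ce'+ec')$. A right $C$-module $M$ is regarded as a right $B$-module by $m\cdot(c,e)=mc$. For an algebra $\Lambda$, $\tau_\Lambda$ and $\tau_\Lambda^{-1}$ are the Auslander–Reiten translations in $\operatorname{mod}\Lambda$, and $\Omega_C^{-1}M$ is the first cosyzygy of $M$. A $\Lambda$-module $X$ is $\tau_\Lambda$-rigid if $\operatorname{Hom}_\Lambda(X,\tau_\Lambda X)=0$. $\operatorname{Gen}M$ is the class of $C$-modules $X$ admitting an epimorphism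 $M^d\to X$ for some integer $d\ge 0$. $\operatorname{Hom}_C(Y,\operatorname{Gen}M)=0$ means $\operatorname{Hom}_C(Y,X)=0$ for all $X\in\operatorname{Gen}M$. *)

(* Defs.v *)
From HB Require Import structures.
From mathcomp Require Import all_boot all_order all_algebra all_field.

Set Implicit Arguments.
Unset Strict Implicit.
Unset Printing Implicit Defensive.

Import GRing.Theory.
Local Open Scope ring_scope.

(* Finite dimensional algebras are [falgType k], so the zero algebra is
   excluded; it has no indecomposable module. *)

Section ConverseAlgebra.
Variables (k : fieldType) (A : falgType k).

HB.instance Definition _ := GRing.Lmodule.copy A^c A.
HB.instance Definition _ := Vector.copy A^c A.

(* The cast fixes the product of A^c; otherwise that of A is inferred. *)
Fact converse_scalerAl (c : k) (x y : A^c) :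
  c *: (x * y) = (c *: x : A^c) * y.
Proof. exact: (@scalerAr k A c y x). Qed.
HB.instance Definition _ :=
  GRing.Lmodule_isLalgebra.Build k A^c converse_scalerAl.

Fact converse_scalerAr (c : k) (x y : A^c) :
  c *: (x * y) = x * (c *: y : A^c).
Proof. exact: (@scalerAl k A c y x). Qed.
HB.instance Definition _ :=
  GRing.Lalgebra_isAlgebra.Build k A^c converse_scalerAr.

End ConverseAlgebra.

(* Finite dimensional right modules; a left A-module is a right module over the
   converse algebra A^c. *)

Record rmod (k : fieldType) (A : falgType k) := RMod {
  rmod_car :> vectType k;
  ract : rmod_car -> A -> rmod_car;
  ract_linearl : forall a, linear (ract^~ a);
  ract_linearr : forall x, linear (ract x);
  ract1 : forall x, ract x 1 = x;
  ractM : forall x a b, ract x (a * b) = ract (ract x a) b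
}.
Arguments ract {k A} r x a.

Section ModuleConstructions.
Variables (k : fieldType) (A : falgType k).

Definition ract_fun (M : rmod A) (a : A) (x : M) : M := ract M x a.
HB.instance Definition _ (M : rmod A) (a : A) :=
  GRing.isLinear.Build k M M *:%R (ract_fun a) (@ract_linearl k A M a).
Definition ract_lfun (M : rmod A) (a : A) : 'End(M) := linfun (@ract_fun M a).

Lemma ract_lfunE (M : rmod A) a x : ract_lfun M a x = ract M x a.
Proof. by rewrite lfunE. Qed.

Fact reg_linearl (a : A) : linear (fun x : A => x * a).
Proof. by move=> c x y; rewrite mulrDl scalerAl. Qed.
Fact reg_linearr (x : A) : linear (fun a : A => x * a).
Proof. by move=> c a b; rewrite mulrDr scalerAr. Qed.
Definition reg : rmod A :=
  @RMod k A A (fun x a => x * a) reg_linearl reg_linearr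
    (@mulr1 A) (@mulrA A).

(* The right module DA = Hom_k(A, k), with (phi a)(x) = phi (a x). *)
Fact dreg_linearl (a : A) :
  linear (fun phi : 'Hom(A, k^o) => (phi \o amull a)%VF).
Proof. by move=> c f g; rewrite comp_lfunDl comp_lfunZl. Qed.
Fact dreg_linearr (phi : 'Hom(A, k^o)) :
  linear (fun a : A => (phi \o amull a)%VF).
Proof. by move=> c a b; rewrite linearP comp_lfunDr comp_lfunZr. Qed.
Fact dreg_act1 (phi : 'Hom(A, k^o)) : (phi \o amull 1)%VF = phi.
Proof. by rewrite amull1 comp_lfun1r. Qed.
Fact dreg_actM (phi : 'Hom(A, k^o)) (a b : A) :
  (phi \o amull (a * b))%VF = ((phi \o amull a) \o amull b)%VF.
Proof.
by apply/lfunP=> x; rewrite !comp_lfunE !lfunE /= mulrA.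
Qed.
Definition dual_reg : rmod A :=
  @RMod k A 'Hom(A, k^o) (fun phi a => (phi \o amull a)%VF)
    dreg_linearl dreg_linearr dreg_act1 dreg_actM.

(* Left multiplication by c on the bimodule DA: (c phi)(x) = phi (x c). *)
Fact dual_reg_lmul_linear (c : A) :
  linear (fun phi : dual_reg => (phi \o amulr c)%VF : dual_reg).
Proof. by move=> a f g; rewrite comp_lfunDl comp_lfunZl. Qed.
Definition dual_reg_lmul_fun (c : A) (phi : dual_reg) : dual_reg :=
  (phi \o amulr c)%VF.
HB.instance Definition _ (c : A) :=
  GRing.isLinear.Build k dual_reg dual_reg *:%R (dual_reg_lmul_fun c)
    (dual_reg_lmul_linear c).
Definition dual_reg_lmul (c : A) : 'End(dual_reg) :=
  linfun (dual_reg_lmul_fun c).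

(* The duality D: (a phi)(x) = phi (x a), a left module. *)
Fact dual_linearl (M : rmod A) (a : A^c) :
  linear (fun phi : 'Hom(M, k^o) => (phi \o ract_lfun M a)%VF).
Proof. by move=> c f g; rewrite comp_lfunDl comp_lfunZl. Qed.
Fact dual_linearr (M : rmod A) (phi : 'Hom(M, k^o)) :
  linear (fun a : A^c => (phi \o ract_lfun M a)%VF).
Proof.
move=> c a b; apply/lfunP=> x; rewrite add_lfunE scale_lfunE !comp_lfunE.
by rewrite !ract_lfunE ract_linearr linearP.
Qed.
Fact dual_act1 (M : rmod A) (phi : 'Hom(M, k^o)) :
  (phi \o ract_lfun M (1 : A^c))%VF = phi.
Proof. by apply/lfunP=> x; rewrite comp_lfunE ract_lfunE ract1. Qed.
Fact dual_actM (M : rmod A) (phi : 'Hom(M, k^o)) (a b : A^c) :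
  (phi \o ract_lfun M (a * b))%VF
    = ((phi \o ract_lfun M a) \o ract_lfun M b)%VF.
Proof. by apply/lfunP=> x; rewrite !comp_lfunE !ract_lfunE -ractM. Qed.
Definition dual (M : rmod A) : rmod A^c :=
  @RMod k A^c 'Hom(M, k^o) (fun phi a => (phi \o ract_lfun M a)%VF)
    (@dual_linearl M) (@dual_linearr M) (@dual_act1 M) (@dual_actM M).

(* A^c^c is convertible to A as a ring, but not as a structure. *)
Definition rmod_cc (M : rmod A^c^c) : rmod A :=
  @RMod k A M (fun x a => ract M x a) (@ract_linearl k _ M)
    (@ract_linearr k _ M) (@ract1 k _ M) (@ractM k _ M).

End ModuleConstructions.
Arguments reg {k} A.
Arguments dual_reg {k} A.
Arguments dual_reg_lmul {k A} c.

Section Modules.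
Variables (k : fieldType) (A : falgType k).
Implicit Types M N P I X Y Z T : rmod A.

Definition is_hom M N (f : 'Hom(M, N)) : Prop :=
  forall x a, f (ract M x a) = ract N (f x) a.

Definition hom_zero M N : Prop := forall f : 'Hom(M, N), is_hom f -> f = 0.

Definition mod_mono M N (f : 'Hom(M, N)) : Prop := is_hom f /\ lker f = 0%VS.
Definition mod_epi M N (f : 'Hom(M, N)) : Prop := is_hom f /\ limg f = fullv.

Definition mod_iso M N : Prop :=
  exists f : 'Hom(M, N), mod_mono f /\ mod_epi f.

Definition is_submod M (U : {vspace M}) : Prop :=
  forall x a, x \in U -> ract M x a \in U.

Definition short_exact X Y Z (f : 'Hom(X, Y)) (g : 'Hom(Y, Z)) : Prop :=
  [/\ mod_mono f, limg f = lker g & mod_epi g].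

Definition indecomposable M : Prop :=
  (fullv : {vspace M}) <> 0%VS /\
  forall U V : {vspace M}, is_submod U -> is_submod V ->
    (U + V)%VS = fullv -> (U :&: V)%VS = 0%VS -> U = 0%VS \/ V = 0%VS.

Definition projective P : Prop :=
  forall X Y (p : 'Hom(X, Y)) (f : 'Hom(P, Y)), mod_epi p -> is_hom f ->
    exists2 g : 'Hom(P, X), is_hom g & f = (p \o g)%VF.

Definition injective_mod I : Prop :=
  forall X Y (i : 'Hom(X, Y)) (f : 'Hom(X, I)), mod_mono i -> is_hom f ->
    exists2 g : 'Hom(Y, I), is_hom g & f = (g \o i)%VF.

Definition superfluous M (U : {vspace M}) : Prop :=
  forall V : {vspace M}, is_submod V -> (U + V)%VS = fullv -> V = fullv.

Definition essential M (U : {vspace M}) : Prop :=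
  forall V : {vspace M}, is_submod V -> (U :&: V)%VS = 0%VS -> V = 0%VS.

Definition injective_envelope M I (i : 'Hom(M, I)) : Prop :=
  [/\ injective_mod I, mod_mono i & essential (limg i)].

(* P1 -> P0 -> M -> 0 exact, with P0 -> M and P1 -> Ker (P0 -> M) projective
   covers. *)
Definition minimal_proj_presentation P1 P0 M
    (p1 : 'Hom(P1, P0)) (p0 : 'Hom(P0, M)) : Prop :=
  [/\ projective P0, mod_epi p0 & superfluous (lker p0)] /\
  [/\ projective P1, is_hom p1, limg p1 = lker p0 & superfluous (lker p1)].

(* N = M_1 (+) ... (+) M_n, given by its injections and projections. *)
Definition is_direct_sum n (M_ : 'I_n -> rmod A) N : Prop :=
  exists (inj : forall i, 'Hom(M_ i, N)) (pr : forall i, 'Hom(N, M_ i)),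
    [/\ forall i, is_hom (inj i),
        forall i, is_hom (pr i),
        forall i, (pr i \o inj i = \1)%VF,
        forall i j, i != j -> (pr j \o inj i = 0)%VF
      & \sum_(i < n) (inj i \o pr i)%VF = \1%VF].

Definition direct_summand X Y : Prop :=
  exists (s : 'Hom(X, Y)) (r : 'Hom(Y, X)),
    [/\ is_hom s, is_hom r & (r \o s = \1)%VF].

Definition in_add T X : Prop :=
  exists n (S_ : 'I_n -> rmod A),
    (forall i, direct_summand (S_ i) T) /\ is_direct_sum S_ X.

Definition in_Gen M X : Prop :=
  exists d (Md : rmod A) (p : 'Hom(Md, X)),
    is_direct_sum (fun _ : 'I_d => M) Md /\ mod_epi p.

Definition hereditary : Prop :=
  forall N P (i : 'Hom(N, P)), projective P -> mod_mono i -> projective N.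

Record proj_resolution X := ProjResolution {
  res_mod :> nat -> rmod A;
  res_d : forall n, 'Hom(res_mod n.+1, res_mod n);
  res_aug : 'Hom(res_mod 0, X);
  res_proj : forall n, projective (res_mod n);
  res_d_hom : forall n, is_hom (res_d n);
  res_aug_epi : mod_epi res_aug;
  res_exact0 : limg (res_d 0) = lker res_aug;
  res_exactS : forall n, limg (res_d n.+1) = lker (res_d n)
}.

Definition ext_cocycle X (R : proj_resolution X) Y n (f : 'Hom(R n, Y)) : Prop :=
  is_hom f /\ (f \o res_d R n = 0)%VF.

Definition ext_coboundary X (R : proj_resolution X) Y n :
    'Hom(R n, Y) -> Prop :=
  match n with
  | 0 => fun f => f = 0
  | m.+1 => fun f => exists2 g : 'Hom(R m, Y), is_hom g & f = (g \o res_d R m)%VF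
  end.

Definition ext_zero n X Y : Prop :=
  forall (R : proj_resolution X) (f : 'Hom(R n, Y)),
    ext_cocycle f -> ext_coboundary f.

(* cls induces an isomorphism from n-cocycles modulo n-coboundaries, that is,
   from Ext^n(X, Y), onto V; its values outside the cocycles are irrelevant. *)
Definition is_ext_class X (R : proj_resolution X) Y n (V : vectType k)
    (cls : 'Hom('Hom(R n, Y), V)) : Prop :=
  (forall v : V, exists2 f : 'Hom(R n, Y), ext_cocycle f & cls f = v) /\
  (forall f : 'Hom(R n, Y), ext_cocycle f -> (cls f = 0 <-> ext_coboundary f)).

Definition is_chain_lift X (R : proj_resolution X) (h : 'End(X))
    (phi : forall n, 'End(R n)) : Prop :=
  [/\ forall n, is_hom (phi n),
      (res_aug R \o phi 0%N = h \o res_aug R)%VF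
    & forall n, (res_d R n \o phi n.+1 = phi n \o res_d R n)%VF].

Definition pd_le1 X : Prop :=
  exists (P1 P0 : rmod A) (p1 : 'Hom(P1, P0)) (p0 : 'Hom(P0, X)),
    [/\ projective P1, projective P0 & short_exact p1 p0].

Definition tilting T : Prop :=
  [/\ pd_le1 T, ext_zero 1 T T &
      exists (T' T'' : rmod A) (f : 'Hom(reg A, T')) (g : 'Hom(T', T'')),
        [/\ in_add T T', in_add T T'' & short_exact f g]].

(* The transpose Tr M = Coker (Hom_A(P0, A) -> Hom_A(P1, A)), where
   (a f)(x) = a f(x) for f in Hom_A(P1, A). *)
Definition is_transpose M (N : rmod A^c) : Prop :=
  exists (P1 P0 : rmod A) (p1 : 'Hom(P1, P0)) (p0 : 'Hom(P0, M))
         (cls : 'Hom('Hom(P1, reg A), N)),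
    [/\ minimal_proj_presentation p1 p0,
        forall y : N, exists2 f : 'Hom(P1, reg A), is_hom f & cls f = y,
        forall f : 'Hom(P1, reg A), is_hom f ->
          (cls f = 0 <->
           exists2 g : 'Hom(P0, reg A), is_hom g & f = (g \o p1)%VF)
      & forall (a : A) (f : 'Hom(P1, reg A)), is_hom f ->
          cls (amull a \o f)%VF = ract N (cls f) a].

Definition is_cosyzygy M N : Prop :=
  exists (I : rmod A) (i : 'Hom(M, I)) (q : 'Hom(I, N)),
    injective_envelope i /\ short_exact i q.

End Modules.

Section AuslanderReiten.
Variables (k : fieldType) (A : falgType k).
Implicit Types M N : rmod A.

(* tau = D Tr and tau^{-1} = Tr D. These, like the transpose and the cosyzygy,
   exist and are unique up to isomorphism, hence are relations; a vanishing of
   Hom is required for every choice of representatives. *)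
Definition is_tau M N : Prop :=
  exists2 T : rmod A^c, is_transpose M T & mod_iso N (rmod_cc (dual T)).

Definition is_tau_inv M N : Prop :=
  exists2 T : rmod A^c^c, is_transpose (dual M) T & mod_iso N (rmod_cc T).

Definition tau_rigid M : Prop := forall N, is_tau M N -> hom_zero M N.

End AuslanderReiten.

(* C is isomorphic to End_A(T), with product the composition of maps. *)
Definition is_end_algebra (k : fieldType) (A C : falgType k) (T : rmod A) :
    Prop :=
  exists phi : 'Hom(C, 'End(T)),
    [/\ lker phi = 0%VS,
        forall h : 'End(T), is_hom h <-> exists c, phi c = h,
        phi 1 = \1%VF
      & forall c d, phi (c * d) = (phi c \o phi d)%VF].

Definition tilted (k : fieldType) (C : falgType k) : Prop :=
  exists (A : falgType k) (T : rmod A),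
    [/\ hereditary A, tilting T & is_end_algebra C T].

Record bimod (k : fieldType) (C : falgType k) := Bimod {
  bimod_car :> vectType k;
  bil : C -> bimod_car -> bimod_car;
  bir : bimod_car -> C -> bimod_car;
  bil_linearl : forall e, linear (bil^~ e);
  bil_linearr : forall c, linear (bil c);
  bir_linearl : forall c, linear (bir^~ c);
  bir_linearr : forall e, linear (bir e);
  bil1 : forall e, bil 1 e = e;
  bir1 : forall e, bir e 1 = e;
  bilM : forall c d e, bil (c * d) e = bil c (bil d e);
  birM : forall c d e, bir e (c * d) = bir (bir e c) d;
  bilr : forall c d e, bir (bil c e) d = bil c (bir e d)
}.
Arguments bil {k C} b c e.
Arguments bir {k C} b e c.

(* E is Ext^2_C(DC, C), with c acting on the left through the endomorphism
   x |-> c x of C_C, and on the right through the endomorphism phi |-> c phi of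
   DC, lifted to a projective resolution. *)
Definition is_ext2_bimod (k : fieldType) (C : falgType k) (E : bimod C) :
    Prop :=
  exists (R : proj_resolution (dual_reg C)) (cls : 'Hom('Hom(R 2, reg C), E)),
    [/\ is_ext_class cls,
        forall (c : C) (f : 'Hom(R 2, reg C)), ext_cocycle f ->
          cls (amull c \o f)%VF = bil E c (cls f)
      & forall (c : C) (phi : forall n, 'End(R n)),
          is_chain_lift (dual_reg_lmul c) phi ->
          forall f : 'Hom(R 2, reg C), ext_cocycle f ->
            cls (f \o phi 2)%VF = bir E (cls f) c].

Definition trivext (k : fieldType) (C : falgType k) (E : bimod C) : Type :=
  (C * E)%type.

Section TrivialExtension.
Variables (k : fieldType) (C : falgType k) (E : bimod C).
Local Notation B := (trivext E).

HB.instance Definition _ := Vector.copy B (C * E)%type.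

Definition trivext_one : B := (1, 0).
Definition trivext_mul (x y : B) : B :=
  (x.1 * y.1, bil E x.1 y.2 + bir E x.2 y.1).

Let bilDl c d e : bil E (c + d) e = bil E c e + bil E d e.
Proof. by have := bil_linearl e 1 c d; rewrite !scale1r. Qed.
Let bilDr c d e : bil E c (d + e) = bil E c d + bil E c e.
Proof. by have := bil_linearr c 1 d e; rewrite !scale1r. Qed.
Let birDl c d e : bir E (d + e) c = bir E d c + bir E e c.
Proof. by have := bir_linearl c 1 d e; rewrite !scale1r. Qed.
Let birDr c d e : bir E e (c + d) = bir E e c + bir E e d.
Proof. by have := bir_linearr e 1 c d; rewrite !scale1r. Qed.
Let bil0 c : bil E c 0 = 0.
Proof. by apply: (@addIr _ (bil E c 0)); rewrite -bilDr !add0r. Qed.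
Let bir0 c : bir E 0 c = 0.
Proof. by apply: (@addIr _ (bir E 0 c)); rewrite -birDl !add0r. Qed.
Let bil00 e : bil E 0 e = 0.
Proof. by apply: (@addIr _ (bil E 0 e)); rewrite -bilDl !add0r. Qed.
Let bir00 e : bir E e 0 = 0.
Proof. by apply: (@addIr _ (bir E e 0)); rewrite -birDr !add0r. Qed.
Let bilZl a c e : bil E (a *: c) e = a *: bil E c e.
Proof. by have := bil_linearl e a c 0; rewrite bil00 !addr0. Qed.
Let bilZr a c e : bil E c (a *: e) = a *: bil E c e.
Proof. by have := bil_linearr c a e 0; rewrite bil0 !addr0. Qed.
Let birZl a c e : bir E (a *: e) c = a *: bir E e c.
Proof. by have := bir_linearl c a e 0; rewrite bir0 !addr0. Qed.
Let birZr a c e : bir E e (a *: c) = a *: bir E e c.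
Proof. by have := bir_linearr e a c 0; rewrite bir00 !addr0. Qed.

Fact trivext_mulA : associative trivext_mul.
Proof.
move=> [a x] [b y] [c z]; congr (_, _); rewrite /= ?mulrA //.
by rewrite bilDr birDl bilM birM bilr addrA.
Qed.
Fact trivext_mul1l : left_id trivext_one trivext_mul.
Proof. by case=> a x; congr (_, _); rewrite /= ?mul1r // bil1 bir0 addr0. Qed.
Fact trivext_mul1r : right_id trivext_one trivext_mul.
Proof. by case=> a x; congr (_, _); rewrite /= ?mulr1 // bir1 bil0 add0r. Qed.
Fact trivext_mulDl : left_distributive trivext_mul +%R.
Proof.
move=> [a x] [b y] [c z]; congr (_, _); rewrite /= ?mulrDl //.
by rewrite bilDl birDl addrACA.
Qed.
Fact trivext_mulDr : right_distributive trivext_mul +%R.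
Proof.
move=> [a x] [b y] [c z]; congr (_, _); rewrite /= ?mulrDr //.
by rewrite bilDr birDr addrACA.
Qed.
Fact trivext_one_neq0 : trivext_one != 0.
Proof. by apply/eqP=> /(congr1 fst)/eqP; rewrite /= oner_eq0. Qed.

HB.instance Definition _ := GRing.Zmodule_isNzRing.Build B
  trivext_mulA trivext_mul1l trivext_mul1r trivext_mulDl trivext_mulDr
  trivext_one_neq0.

Fact trivext_scalerAl (a : k) (x y : B) : a *: (x * y) = (a *: x) * y.
Proof.
case: x y => [c x] [d y]; congr (_, _); rewrite /= ?scalerAl //.
by rewrite scalerDr bilZl birZl.
Qed.
HB.instance Definition _ :=
  GRing.Lmodule_isLalgebra.Build k B trivext_scalerAl.

Fact trivext_scalerAr (a : k) (x y : B) : a *: (x * y) = x * (a *: y).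
Proof.
case: x y => [c x] [d y]; congr (_, _); rewrite /= ?scalerAr //.
by rewrite scalerDr bilZr birZr.
Qed.
HB.instance Definition _ :=
  GRing.Lalgebra_isAlgebra.Build k B trivext_scalerAr.

HB.instance Definition _ := Algebra_isFalgebra.Build k B.

Variable M : rmod C.
Fact inflate_linearl (b : B) : linear (fun x : M => ract M x b.1).
Proof. exact: ract_linearl. Qed.
Fact inflate_linearr (x : M) : linear (fun b : B => ract M x b.1).
Proof. by move=> a b c; rewrite -ract_linearr. Qed.
Fact inflate1 (x : M) : ract M x (1 : B).1 = x.
Proof. exact: ract1. Qed.
Fact inflateM (x : M) (b c : B) :
  ract M x (b * c).1 = ract M (ract M x b.1) c.1.
Proof. exact: ractM. Qed.
Definition inflate : rmod B :=
  @RMod k B M (fun x b => ract M x b.1)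
    inflate_linearl inflate_linearr inflate1 inflateM.

End TrivialExtension.
Arguments inflate {k C} E M.

(* Main.v *)
From HB Require Import structures.
Require Import Defs.
From mathcomp Require Import all_boot all_order all_algebra all_field.
From Stdlib Require Import Classical ClassicalEpsilon.

Set Implicit Arguments.
Unset Strict Implicit.
Unset Printing Implicit Defensive.

Import GRing.Theory.
Local Open Scope ring_scope.

(** The proof has three parts. Write [Gen M] for the modules generated by [M].

    Over any algebra, [M] is tau-rigid if and only if [Ext^1(M, X) = 0] for all
    [X] in [Gen M] ([tau_rigid_ext1]). For a minimal presentation [P1 -> P0 ->
    M], the space [Hom(M, tau M)] is dual to the cokernel of [Hom(P0, M) ->
    Hom(P1, M)], and minimality translates the vanishing of this cokernel into
    that of all [Ext^1(M, X)].

    For [C]-modules [M] and [X], the space [Ext^1(M, X)] over [B] is the direct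
    sum of [Ext^1_C(M, X)] and [Hom_C(M (x) E, X)] ([ext1_inflate]): if [P -> M]
    is a projective cover over [C] with kernel [K], then the kernel of [P (x) B
    -> M] modulo its multiple by [E] is the direct sum of [K] and [M (x) E].
    Moreover [E] annihilates all [B]-modules generated by [M], so both algebras
    give the same [Gen M]. Hence a tau-rigid [C]-module [M] is tau-rigid over
    [B] if and only if [Hom_C(M (x) E, Gen M) = 0] ([tau_rigid_inflate]). The
    module [M (x) E] is never formed: the maps from it are the balanced bilinear
    maps on [M x E].

    It remains to identify the maps from [M (x) E] with those from [tau^{-1}
    Omega^{-1} M] ([hom_zero_balanced]). A tilted algebra has global dimension
    at most 2. Hence [Ext^2] is right exact, and [M (x) Ext^2(DC, C)] is
    [Ext^2(DC, M)]. On the other hand, for an injective coresolution [0 -> M ->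
    I0 -> I1 -> I2 -> 0] the module [tau^{-1} Omega^{-1} M] is the cokernel of
    [Hom(DC, I1) -> Hom(DC, I2)], which is [Ext^2(DC, M)] as well. The two
    computations, by a projective resolution of [DC] and by an injective one of
    [M], are compared by the relation [connected].

    The bound on the global dimension ([kernel_projective]) says that, for [C =
    End T], the kernel of a map between projective [C]-modules is projective.
    Such a kernel consists of the maps from [T] to a submodule of a power of
    [T]; the trace of [T] in that submodule is a direct summand of a power of
    [T], because the ground algebra is hereditary and [T] has no self-extensions
    ([trace_splits]). Exchanging syzygies for cosyzygies by dimension shifting,
    one gets injective coresolutions of length two. *)

(** * Linear algebra *)

Section LinearAlgebra.
Variable k : fieldType.
Implicit Types V W : vectType k.

Lemma lfun_ex V W (g : V -> W) : linear g -> exists f : 'Hom(V, W), f =1 g.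
Proof.
move=> Hg; pose Lm := GRing.isLinear.Build k V W *:%R g Hg.
pose l : {linear V -> W} := HB.pack g Lm.
by exists (linfun l) => x; rewrite lfunE.
Qed.

Lemma subspace_ex V (S : V -> Prop) :
  S 0 -> (forall a x y, S x -> S y -> S (a *: x + y)) ->
  exists U : {vspace V}, forall x, x \in U <-> S x.
Proof.
move=> S0 Sl.
suff H n (U : {vspace V}) : (forall x, x \in U -> S x) ->
    (\dim {:V} <= \dim U + n)%N ->
    exists U' : {vspace V}, forall x, x \in U' <-> S x.
  apply: (H (\dim {:V}) 0%VS); last exact: leq_addl.
  by move=> x; rewrite memv0 => /eqP->.
elim: n U => [|n IHn] U US dU.
  exists U => x; split; first exact: US.
  move=> _; have /eqP -> : U == fullv by rewrite eqEdim subvf -[\dim U]addn0.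
  exact: memvf.
case: (classic (forall x, S x -> x \in U)) => [SU | /not_all_ex_not[v Hv]].
  by exists U => x; split; [exact: US | exact: SU].
have [Sv vU] : S v /\ ~ (v \in U) by apply: imply_to_and.
apply: (IHn (U + <[v]>)%VS).
  move=> x /memv_addP[u uU [w /vlineP[a ->] ->]].
  by rewrite addrC; apply: Sl => //; apply: US.
apply: leq_trans dU _; rewrite addnS -addSn leq_add2r.
rewrite ltn_neqAle dimvS ?addvSl // andbT.
apply/negP=> /eqP Hd; apply: vU.
have /eqP -> : U == (U + <[v]>)%VS by rewrite eqEdim addvSl Hd leqnn.
by apply: (subvP (addvSr U _)); apply: memv_line.
Qed.

Lemma separating_form V (U : {vspace V}) x : x \notin U ->
  exists phi : 'Hom(V, k^o), phi x = 1 /\ forall y, y \in U -> phi y = 0.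
Proof.
move=> xU; pose q : 'End(V) := (\1 - projv U)%VF.
have qx0 : q x != 0.
  rewrite add_lfunE opp_lfunE id_lfunE subr_eq0; apply: contra xU => /eqP ->.
  exact: memv_proj.
pose X := vbasis {:V}.
have [i Hi] : exists i, coord X i (q x) != 0.
  apply: NNPP => /not_ex_all_not H; move/eqP: qx0; apply.
  rewrite (coord_vbasis (memvf (q x))) big1 // => i _.
  by move/negP: (H i) => /negPn /eqP ->; rewrite scale0r.
have [|phi Hphi] := @lfun_ex V k^o
  (fun y => (coord X i (q x))^-1 * coord X i (q y)).
  by move=> a u v; rewrite !linearP /= mulrDr mulrCA.
exists phi; split=> [|y yU]; rewrite Hphi ?mulVf //.
have -> : q y = 0 by rewrite add_lfunE opp_lfunE id_lfunE projv_id ?subrr.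
by rewrite linear0 mulr0.
Qed.

Lemma form_sep V (x : V) : (forall phi : 'Hom(V, k^o), phi x = 0) -> x = 0.
Proof.
move=> H; apply/eqP; rewrite -memv0; apply: contraT => /separating_form[phi].
by rewrite H => -[/eqP]; rewrite eq_sym oner_eq0.
Qed.

Lemma form_is_eval V (Phi : 'Hom('Hom(V, k^o), k^o)) :
  exists x : V, forall phi, Phi phi = phi x.
Proof.
pose X := vbasis {:V}.
have /fin_all_exists[c Hc] : forall i : 'I_(\dim {:V}), exists c : 'Hom(V, k^o),
    forall x, c x = coord X i x :> k^o.
  move=> i; apply: (@lfun_ex V k^o (coord X i)) => a u v.
  by rewrite linearP.
exists (\sum_(i < \dim {:V}) (Phi (c i) : k) *: X`_i) => phi.
have -> : phi = \sum_(i < \dim {:V}) (phi X`_i : k) *: c i.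
  apply/lfunP=> x; rewrite {1}(coord_vbasis (memvf x)) linear_sum sum_lfunE.
  by apply: eq_bigr => i _; rewrite scale_lfunE linearZ /= Hc [LHS]mulrC.
rewrite [LHS]linear_sum sum_lfunE /=.
apply: eq_bigr => i _; rewrite scale_lfunE linearZ /=.
congr (_ *: _); rewrite Hc linear_sum (bigD1 i) //= big1.
  rewrite linearZ /= (coord_free _ _ (basis_free (vbasisP _))).
  by rewrite eqxx addr0 /= mulr1.
move=> j ji; rewrite linearZ /= (coord_free _ _ (basis_free (vbasisP _))).
by rewrite (negPf ji) mulr0.
Qed.

(** Connecting homomorphisms and the coordinate functions of a kernel arise
    below only as relations, through chains of liftings. *)
Lemma linear_relation V W (U : {vspace V}) (rho : V -> W -> Prop) :
  (forall x, x \in U -> exists y, rho x y) ->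
  (forall a x x' y y',
     rho x y -> rho x' y' -> rho (a *: x + x') (a *: y + y')) ->
  (forall y, rho 0 y -> y = 0) ->
  exists f : 'Hom(V, W), forall x y, x \in U -> rho x y -> f x = y.
Proof.
move=> tot lin zero.
pose g (x : subvs_of U) : W :=
  proj1_sig (constructive_indefinite_description _ (tot (vsval x) (subvsP x))).
have gP x : rho (vsval x) (g x).
  exact: proj2_sig (constructive_indefinite_description _ _).
have func x y y' : rho x y -> rho x y' -> y = y'.
  move=> Hy Hy'; have := lin (-1) _ _ _ _ Hy Hy'.
  by rewrite !scaleN1r addNr => /zero/eqP; rewrite addrC subr_eq0 => /eqP.
have [|f Hf] := @lfun_ex _ W g.
  move=> a x y; apply: (func (vsval (a *: x + y))); first exact: gP.
  by rewrite linearP; apply: lin; apply: gP.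
exists (f \o linfun (vsproj U))%VF => x y xU Hy.
rewrite comp_lfunE lfunE Hf; apply: func Hy.
by rewrite -{1}(vsprojK xU); apply: gP.
Qed.

Lemma linear_section V W (U : {vspace V}) (c : 'Hom(V, W)) :
  (forall w, exists2 v, v \in U & c v = w) ->
  exists s : 'Hom(W, V), forall w, s w \in U /\ c (s w) = w.
Proof.
move=> surj; pose c' : 'Hom(subvs_of U, W) := (c \o linfun vsval)%VF.
have c'E x : c' x = c (vsval x) by rewrite comp_lfunE lfunE.
exists (linfun vsval \o c'^-1)%VF => w.
rewrite comp_lfunE lfunE /= subvsP; split=> //; rewrite -c'E limg_lfunVK //.
have [v vU <-] := surj w.
by rewrite -{1}(vsprojK vU) -c'E memv_img ?memvf.
Qed.

(** Double transposition, by reflexivity of [W]. *)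
Lemma transposed V W (e : 'Hom('Hom(W, k^o), 'Hom(V, k^o))) :
  exists d : 'Hom(V, W), forall (phi : 'Hom(W, k^o)) x, phi (d x) = e phi x.
Proof.
have ex_d x : exists y : W, forall phi : 'Hom(W, k^o), phi y = e phi x.
  have [|Phi HPhi] := @lfun_ex 'Hom(W, k^o) k^o (fun phi => e phi x).
    by move=> a f g; rewrite linearP add_lfunE scale_lfunE.
  have [y Hy] := form_is_eval Phi.
  by exists y => phi; rewrite -Hy HPhi.
have [|||d Hd] := @linear_relation V W fullv
  (fun x y => forall phi : 'Hom(W, k^o), phi y = e phi x).
- by move=> x _; apply: ex_d.
- by move=> a x x' y y' H H' phi; rewrite !linearP /= H H'.
- by move=> y H; apply: form_sep => phi; rewrite H linear0.
exists d => phi x; have [y Hy] := ex_d x.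
by rewrite (Hd x y) ?memvf.
Qed.

Lemma bilinear_ex V W (Z : vectType k) (b : V -> W -> Z) :
  (forall w, linear (b^~ w)) -> (forall v, linear (b v)) ->
  exists f : 'Hom(V, 'Hom(W, Z)), forall v w, f v w = b v w.
Proof.
move=> Hl Hr.
pose g v : 'Hom(W, Z) :=
  proj1_sig (constructive_indefinite_description _ (lfun_ex (Hr v))).
have gE v : g v =1 b v.
  by rewrite /g; case: constructive_indefinite_description.
have [|f Hf] := @lfun_ex V _ g; last by exists f => v w; rewrite Hf gE.
by move=> a u v; apply/lfunP => w; rewrite add_lfunE scale_lfunE !gE Hl.
Qed.

End LinearAlgebra.

(** * Modules: homomorphisms, submodules, quotients, projectives *)

Section ModuleBasics.
Variables (k : fieldType) (A : falgType k).
Implicit Types M N P X Y Z : rmod A.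

Definition orbit_fun M (x : M) (a : reg A) : M := ract M x a.
HB.instance Definition _ M (x : M) :=
  GRing.isLinear.Build k (reg A) M *:%R (orbit_fun x) (@ract_linearr k A M x).
Definition orbit_map M (x : M) : 'Hom(reg A, M) := linfun (orbit_fun x).

Lemma orbit_mapE M (x : M) (a : A) : orbit_map x a = ract M x a.
Proof. by rewrite lfunE. Qed.

Lemma orbit_map_lin M c (x y : M) :
  orbit_map (c *: x + y) = c *: orbit_map x + orbit_map y.
Proof.
by apply/lfunP => a; rewrite add_lfunE scale_lfunE !orbit_mapE ract_linearl.
Qed.

(** The map [amull a] with the module [reg A] as its source and target, so that
    it composes with homomorphisms. *)
Definition lmul (a : A) : 'End(reg A) := amull a.

Lemma lmulE (a x : A) : lmul a x = a * x.
Proof. by rewrite lfunE. Qed.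

Lemma ractDl M (x y : M) a : ract M (x + y) a = ract M x a + ract M y a.
Proof. by rewrite -!ract_lfunE linearD. Qed.
Lemma ractZl M c (x : M) a : ract M (c *: x) a = c *: ract M x a.
Proof. by rewrite -!ract_lfunE linearZ. Qed.
Lemma ractBl M (x y : M) a : ract M (x - y) a = ract M x a - ract M y a.
Proof. by rewrite -!ract_lfunE linearB. Qed.
Lemma ract0l M a : ract M 0 a = 0.
Proof. by rewrite -ract_lfunE linear0. Qed.
Lemma ract_suml M I r (Q : pred I) (F : I -> M) a :
  ract M (\sum_(i <- r | Q i) F i) a = \sum_(i <- r | Q i) ract M (F i) a.
Proof.
by rewrite -ract_lfunE linear_sum; apply: eq_bigr => i _; exact: ract_lfunE.
Qed.
Lemma ractDr M (x : M) a b : ract M x (a + b) = ract M x a + ract M x b.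
Proof. by rewrite -!orbit_mapE linearD. Qed.
Lemma ractZr M c (x : M) a : ract M x (c *: a) = c *: ract M x a.
Proof. by rewrite -!orbit_mapE linearZ. Qed.
Lemma ract0r M (x : M) : ract M x 0 = 0.
Proof. by rewrite -orbit_mapE linear0. Qed.
Lemma is_hom_orbit M (x : M) : is_hom (orbit_map x).
Proof. by move=> a b; rewrite !orbit_mapE ractM. Qed.

Lemma is_hom_lmul (a : A) : is_hom (lmul a).
Proof. by move=> x b; rewrite !lmulE mulrA. Qed.

Lemma is_hom_id M : is_hom (\1%VF : 'End(M)).
Proof. by move=> x a; rewrite !id_lfunE. Qed.

Lemma is_hom0 M N : is_hom (0 : 'Hom(M, N)).
Proof. by move=> x a; rewrite !zero_lfunE ract0l. Qed.

Lemma is_hom_comp M N P (g : 'Hom(N, P)) (f : 'Hom(M, N)) :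
  is_hom g -> is_hom f -> is_hom (g \o f)%VF.
Proof. by move=> Hg Hf x a; rewrite !comp_lfunE Hf Hg. Qed.

Lemma is_hom_lin M N c (f g : 'Hom(M, N)) :
  is_hom f -> is_hom g -> is_hom (c *: f + g).
Proof.
move=> Hf Hg x a; rewrite !add_lfunE !scale_lfunE Hf Hg.
by rewrite ractDl ractZl.
Qed.

Lemma is_homD M N (f g : 'Hom(M, N)) : is_hom f -> is_hom g -> is_hom (f + g).
Proof. by move=> Hf Hg; rewrite -[f]scale1r; apply: is_hom_lin. Qed.

Lemma is_homB M N (f g : 'Hom(M, N)) : is_hom f -> is_hom g -> is_hom (f - g).
Proof.
by move=> Hf Hg; rewrite addrC -scaleN1r; apply: is_hom_lin.
Qed.

Lemma is_hom_sum M N n (f : 'I_n -> 'Hom(M, N)) :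
  (forall i, is_hom (f i)) -> is_hom (\sum_i f i).
Proof.
move=> Hf; elim/big_ind: _ => //; first exact: is_hom0.
by move=> g h; apply: is_homD.
Qed.

Lemma hom_space M N :
  exists H : {vspace 'Hom(M, N)}, forall f, f \in H <-> is_hom f.
Proof.
by apply: subspace_ex => [|a f g]; [apply: is_hom0 | apply: is_hom_lin].
Qed.

Lemma mod_mono_inj M N (f : 'Hom(M, N)) : mod_mono f -> injective f.
Proof. by case=> _ /eqP/lker0P. Qed.

Lemma mono_ker M N (f : 'Hom(M, N)) x : mod_mono f -> f x = 0 -> x = 0.
Proof. by move=> /mod_mono_inj Hf fx; apply: Hf; rewrite fx linear0. Qed.

Lemma monoI M N (f : 'Hom(M, N)) :
  is_hom f -> (forall x, f x = 0 -> x = 0) -> mod_mono f.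
Proof.
move=> Hf H; split=> //; apply/vspaceP => x; rewrite memv_ker memv0.
by apply/eqP/eqP => [/H | ->]; rewrite ?linear0.
Qed.

Lemma epi_surj M N (f : 'Hom(M, N)) y : mod_epi f -> exists x, f x = y.
Proof.
case=> _ Hf; have: y \in limg f by rewrite Hf memvf.
by move=> /memv_imgP[x _ ->]; exists x.
Qed.

Lemma epiI M N (f : 'Hom(M, N)) :
  is_hom f -> (forall y, exists x, f x = y) -> mod_epi f.
Proof.
move=> Hf H; split=> //; apply/vspaceP => y; rewrite memvf.
by have [x <-] := H y; rewrite memv_img ?memvf.
Qed.

Lemma memv_limgP (V W : vectType k) (f : 'Hom(V, W)) y :
  y \in limg f <-> exists x, f x = y.
Proof.
split=> [/memv_imgP[x _ ->]|[x <-]]; first by exists x.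
by rewrite memv_img ?memvf.
Qed.

Lemma is_submod_ker M N (f : 'Hom(M, N)) : is_hom f -> is_submod (lker f).
Proof. by move=> Hf x a; rewrite !memv_ker Hf => /eqP ->; rewrite ract0l. Qed.

Lemma is_submod_img M N (f : 'Hom(M, N)) : is_hom f -> is_submod (limg f).
Proof.
move=> Hf x a /memv_limgP[y <-]; rewrite -Hf.
by apply/memv_limgP; exists (ract M y a).
Qed.

Lemma lift_mono X Y Z (i : 'Hom(X, Y)) (f : 'Hom(Z, Y)) :
  mod_mono i -> is_hom f -> (forall z, f z \in limg i) ->
  exists2 g : 'Hom(Z, X), is_hom g & forall z, i (g z) = f z.
Proof.
move=> Hi Hf Hfi; have K z : i ((i^-1 \o f)%VF z) = f z.
  by rewrite comp_lfunE limg_lfunVK.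
exists (i^-1 \o f)%VF => // z a.
by apply: (mod_mono_inj Hi); rewrite K; case: Hi => -> _; rewrite K.
Qed.

Lemma factor_epi X Y Z (p : 'Hom(X, Y)) (f : 'Hom(X, Z)) :
  mod_epi p -> is_hom f -> (forall x, p x = 0 -> f x = 0) ->
  exists2 g : 'Hom(Y, Z), is_hom g & forall x, g (p x) = f x.
Proof.
move=> Hp Hf Hpf; have K x : (f \o p^-1)%VF (p x) = f x.
  rewrite comp_lfunE; apply/eqP; rewrite -subr_eq0 -linearB.
  apply/eqP/Hpf; rewrite linearB /= limg_lfunVK ?subrr //.
  by rewrite memv_img ?memvf.
exists (f \o p^-1)%VF => // y a; have [x <-] := epi_surj y Hp.
by case: (Hp) => Hph _; rewrite -Hph !K.
Qed.

Lemma submodule_ex M (U : {vspace M}) : is_submod U ->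
  exists (S : rmod A) (i : 'Hom(S, M)), mod_mono i /\ limg i = U.
Proof.
move=> HU.
pose act (x : subvs_of U) a : subvs_of U := vsproj U (ract M (vsval x) a).
have actE x a : vsval (act x a) = ract M (vsval x) a.
  by rewrite vsprojK // HU // subvsP.
have vsvalP c (x y : subvs_of U) :
  vsval (c *: x + y) = c *: vsval x + vsval y by [].
have linl a : linear (act^~ a).
  by move=> c x y; apply: subvs_inj; rewrite vsvalP !actE vsvalP ractDl ractZl.
have linr x : linear (act x).
  by move=> c a b; apply: subvs_inj; rewrite vsvalP !actE ractDr ractZr.
have act1 x : act x 1 = x by apply: subvs_inj; rewrite actE ract1.
have actM x a b : act x (a * b) = act (act x a) b.
  by apply: subvs_inj; rewrite !actE ractM.
pose S := RMod linl linr act1 actM.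
pose i : 'Hom(S, M) := linfun (vsval : subvs_of U -> M).
have iE x : i x = vsval x by rewrite lfunE.
exists S, i; split.
  apply: monoI => [x a|x]; first by rewrite !iE actE.
  by rewrite iE => x0; apply: subvs_inj.
apply/vspaceP => x; apply/idP/idP => [/memv_limgP[y <-]|xU].
  by rewrite iE subvsP.
by apply/memv_limgP; exists (vsproj U x); rewrite iE vsprojK.
Qed.

Lemma quotient_ex M (U : {vspace M}) : is_submod U ->
  exists (Q : rmod A) (p : 'Hom(M, Q)), mod_epi p /\ lker p = U.
Proof.
move=> HU; pose q : 'End(M) := (\1 - projv U)%VF.
have qE x : q x = x - projv U x by rewrite add_lfunE opp_lfunE id_lfunE.
have q0 x : (q x == 0) = (x \in U).
  rewrite qE subr_eq0; apply/eqP/idP => [->|/projv_id-> //].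
  exact: memv_proj.
have qq x : q (q x) = q x.
  by rewrite [q (q x)]qE {2}qE linearB /= projv_proj subrr subr0.
have qa x a : q (ract M (q x) a) = q (ract M x a).
  apply/eqP; rewrite -subr_eq0 -linearB -ractBl q0; apply: HU.
  by rewrite -q0 linearB /= qq subrr.
pose V := limg q; have qV x : q x \in V by apply/memv_limgP; exists x.
have Vq x : x \in V -> q x = x by move=> /memv_limgP[y <-]; rewrite qq.
pose act (x : subvs_of V) a : subvs_of V := vsproj V (q (ract M (vsval x) a)).
have actE x a : vsval (act x a) = q (ract M (vsval x) a) by rewrite vsprojK.
have vsvalP c (x y : subvs_of V) :
  vsval (c *: x + y) = c *: vsval x + vsval y by [].
have linl a : linear (act^~ a).
  move=> c x y; apply: subvs_inj.
  by rewrite vsvalP !actE vsvalP ractDl ractZl linearP.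
have linr x : linear (act x).
  by move=> c a b; apply: subvs_inj; rewrite vsvalP !actE ractDr ractZr linearP.
have act1 x : act x 1 = x by apply: subvs_inj; rewrite actE ract1 Vq ?subvsP.
have actM x a b : act x (a * b) = act (act x a) b.
  by apply: subvs_inj; rewrite !actE ractM qa.
pose Q := RMod linl linr act1 actM.
pose p : 'Hom(M, Q) := (linfun (vsproj V) \o q)%VF.
have pE x : vsval (p x) = q x by rewrite comp_lfunE lfunE /= vsprojK.
exists Q, p; split.
  apply: epiI => [x a|y].
    by apply: subvs_inj; rewrite pE actE pE qa.
  by exists (vsval y); apply: subvs_inj; rewrite pE Vq ?subvsP.
apply/vspaceP => x; rewrite memv_ker -q0 -pE.
by apply/eqP/eqP => [-> // | H]; apply: subvs_inj.
Qed.

Lemma kernel_ex M N (f : 'Hom(M, N)) : is_hom f ->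
  exists (K : rmod A) (i : 'Hom(K, M)), mod_mono i /\ limg i = lker f.
Proof. by move=> Hf; apply/submodule_ex/is_submod_ker. Qed.

Lemma image_factor M N (f : 'Hom(M, N)) : is_hom f ->
  exists (L : rmod A) (i : 'Hom(L, N)) (p : 'Hom(M, L)),
    [/\ mod_mono i, mod_epi p, limg i = limg f & forall x, i (p x) = f x].
Proof.
move=> Hf; have [L [i [Hi iE]]] := submodule_ex (is_submod_img Hf).
have [|p Hp pE] := lift_mono Hi Hf.
  by move=> z; rewrite iE; apply/memv_limgP; exists z.
exists L, i, p; split=> //; apply: epiI => // y.
have /memv_limgP[x Hx] : i y \in limg f.
  by rewrite -iE; apply/memv_limgP; exists y.
by exists x; apply: (mod_mono_inj Hi); rewrite pE.
Qed.

Section Power.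
Variables (M : rmod A) (n : nat).

Definition pow_act (x : {ffun 'I_n -> M}) (a : A) : {ffun 'I_n -> M} :=
  [ffun i => ract M (x i) a].
Fact pow_linearl a : linear (pow_act^~ a).
Proof. by move=> c x y; apply/ffunP => i; rewrite !ffunE ractDl ractZl. Qed.
Fact pow_linearr x : linear (pow_act x).
Proof. by move=> c a b; apply/ffunP => i; rewrite !ffunE ractDr ractZr. Qed.
Fact pow_act1 x : pow_act x 1 = x.
Proof. by apply/ffunP => i; rewrite !ffunE ract1. Qed.
Fact pow_actM x a b : pow_act x (a * b) = pow_act (pow_act x a) b.
Proof. by apply/ffunP => i; rewrite !ffunE ractM. Qed.

Definition pow : rmod A :=
  @RMod k A {ffun 'I_n -> M} pow_act pow_linearl pow_linearr pow_act1 pow_actM.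

End Power.

(** Elements of [pow M n] do not coerce to functions, as their type is only
    convertible to a type of finite functions. *)
Definition component M n (x : pow M n) : {ffun 'I_n -> M} := x.

Lemma component_act M n (x : pow M n) a i :
  component (ract (pow M n) x a) i = ract M (component x i) a.
Proof. by rewrite ffunE. Qed.

Lemma pow_proj M n (i : 'I_n) :
  exists2 f : 'Hom(pow M n, M), is_hom f & forall x, f x = component x i.
Proof.
have [|f Hf] := @lfun_ex k (pow M n) M (fun x => component x i).
  by move=> c x y; rewrite !ffunE.
by exists f => // x a; rewrite !Hf component_act.
Qed.

Lemma pow_pair M n Z (f : 'I_n -> 'Hom(Z, M)) : (forall i, is_hom (f i)) ->
  exists2 g : 'Hom(Z, pow M n), is_hom g &
    forall z i, component (g z) i = f i z.
Proof.
move=> Hf; have [|g Hg] := @lfun_ex k Z (pow M n)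
    (fun z => ([ffun i => f i z] : {ffun 'I_n -> M})).
  by move=> c x y; apply/ffunP => i; rewrite !ffunE linearP.
exists g => [x a|z i]; last by rewrite Hg ffunE.
by apply/ffunP => i; rewrite !Hg !ffunE Hf.
Qed.

Lemma pow_copair M n Z (f : 'I_n -> 'Hom(M, Z)) : (forall i, is_hom (f i)) ->
  exists2 g : 'Hom(pow M n, Z), is_hom g &
    forall x, g x = \sum_i f i (component x i).
Proof.
move=> Hf.
have [|g Hg] := @lfun_ex k (pow M n) Z (fun x => \sum_i f i (component x i)).
  move=> c x y; rewrite scaler_sumr -big_split; apply: eq_bigr => i _.
  by rewrite !ffunE linearP.
exists g => // x a; rewrite !Hg ract_suml; apply: eq_bigr => i _.
by rewrite component_act Hf.
Qed.

(** A dual basis writes the identity of [P] as a sum of maps factoring through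
    [A]; its existence characterizes finitely generated projective modules. *)
Definition dual_basis P n (x : 'I_n -> P) (phi : 'I_n -> 'Hom(P, reg A)) :=
  (forall i, is_hom (phi i)) /\
  forall y, y = \sum_i ract P (x i) (phi i y).

Lemma dual_basis_projective P n (x : 'I_n -> P) phi :
  dual_basis x phi -> projective P.
Proof.
case=> Hphi Hx X Y p f Hp Hf.
have /fin_all_exists[z Hz] i : exists z, p z = f (x i) by apply: epi_surj.
exists (\sum_i (orbit_map (z i) \o phi i)%VF).
  by apply: is_hom_sum => i; apply: is_hom_comp => //; apply: is_hom_orbit.
apply/lfunP => y; rewrite comp_lfunE sum_lfunE {1}(Hx y) !linear_sum.
apply: eq_bigr => i _; rewrite /= comp_lfunE orbit_mapE Hf -Hz.
by case: Hp => ->.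
Qed.

Lemma free_projective n : projective (pow (reg A) n).
Proof.
have /fin_all_exists[phi Hphi] (i : 'I_n) :
    exists phi : 'Hom(pow (reg A) n, reg A),
      is_hom phi /\ forall x, phi x = component x i.
  by have [phi H1 H2] := pow_proj (reg A) i; exists phi.
pose e (i : 'I_n) : pow (reg A) n :=
  ([ffun j => (i == j)%:R] : {ffun 'I_n -> A}).
apply: (dual_basis_projective (x := e) (phi := phi)).
split=> [i|y]; first by case: (Hphi i).
apply/ffunP => j; rewrite sum_ffunE (bigD1 j) //= big1 => [|i ij].
  by rewrite addr0 ffunE (proj2 (Hphi j)) /e ffunE eqxx [RHS]mul1r.
by rewrite ffunE /e ffunE (negPf ij) [LHS]mul0r.
Qed.

Lemma free_cover M n (x : 'I_n -> M) :
  exists2 p : 'Hom(pow (reg A) n, M), is_hom p &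
    forall v, p v = \sum_i ract M (x i) (component v i).
Proof.
have [|p Hp pE] := @pow_copair (reg A) n M (fun i => orbit_map (x i)).
  by move=> i; apply: is_hom_orbit.
by exists p => // v; rewrite pE; apply: eq_bigr => i _; rewrite orbit_mapE.
Qed.

Lemma generators M : exists n (x : 'I_n -> M),
  forall y, exists a : 'I_n -> A, y = \sum_i ract M (x i) (a i).
Proof.
exists (\dim {:M}), (fun i => (vbasis {:M})`_i) => y.
exists (fun i => (coord (vbasis {:M}) i y)%:A).
rewrite {1}(coord_vbasis (memvf y)); apply: eq_bigr => i _.
by rewrite ractZr ract1.
Qed.

Lemma projective_epi_ex M : exists (P : rmod A) (p : 'Hom(P, M)),
  projective P /\ mod_epi p.
Proof.
have [n [x Hx]] := generators M; have [p Hp pE] := free_cover x.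
exists (pow (reg A) n), p; split; first exact: free_projective.
apply: epiI => // y; have [a ->] := Hx y.
exists ([ffun i => a i] : {ffun 'I_n -> A}).
by rewrite pE; apply: eq_bigr => i _; rewrite ffunE.
Qed.

Lemma projective_lift P X Y (p : 'Hom(X, Y)) (f : 'Hom(P, Y)) :
  projective P -> mod_epi p -> is_hom f ->
  exists2 g : 'Hom(P, X), is_hom g & forall x, p (g x) = f x.
Proof.
move=> HP Hp Hf; have [g Hg ->] := HP _ _ _ _ Hp Hf.
by exists g => // x; rewrite comp_lfunE.
Qed.

Lemma projective_dual_basis P : projective P ->
  exists n (x : 'I_n -> P) phi, dual_basis x phi.
Proof.
move=> HP; have [n [x Hx]] := generators P; have [p Hp pE] := free_cover x.
have epi_p : mod_epi p.
  apply: epiI => // y; have [a ->] := Hx y.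
  exists ([ffun i => a i] : {ffun 'I_n -> A}).
  by rewrite pE; apply: eq_bigr => i _; rewrite ffunE.
have [s Hs sE] := projective_lift HP epi_p (@is_hom_id P).
have /fin_all_exists[phi Hphi] (i : 'I_n) : exists phi : 'Hom(P, reg A),
    is_hom phi /\ forall y, phi y = component (s y) i.
  have [f Hf fE] := pow_proj (reg A) i; exists (f \o s)%VF; split.
    exact: is_hom_comp.
  by move=> y; rewrite comp_lfunE fE.
exists n, x, phi; split=> [i|y]; first by case: (Hphi i).
rewrite -{1}[y]id_lfunE -sE pE; apply: eq_bigr => i _.
by rewrite (proj2 (Hphi i)).
Qed.

Lemma retract_projective P (Q : rmod A) (s : 'Hom(Q, P)) (r : 'Hom(P, Q)) :
  projective P -> is_hom s -> is_hom r -> (forall x, r (s x) = x) ->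
  projective Q.
Proof.
move=> HP Hs Hr rs X Y p f Hp Hf.
have [g Hg gE] := projective_lift HP Hp (is_hom_comp Hf Hr).
exists (g \o s)%VF; first exact: is_hom_comp.
by apply/lfunP => x; rewrite !comp_lfunE gE comp_lfunE rs.
Qed.

(** [Ext^1(M, X)] is the cokernel of [Hom(P, X) -> Hom(K, X)]. *)
Definition ext1_vanishes M X : Prop :=
  forall (P K : rmod A) (p : 'Hom(P, M)) (i : 'Hom(K, P)),
    projective P -> short_exact i p ->
  forall f : 'Hom(K, X), is_hom f ->
    exists2 g : 'Hom(P, X), is_hom g & forall x, g (i x) = f x.

Lemma exactP X Y Z (f : 'Hom(X, Y)) (g : 'Hom(Y, Z)) y :
  limg f = lker g -> g y = 0 -> exists x, f x = y.
Proof. by move=> E gy; apply/memv_limgP; rewrite E memv_ker gy. Qed.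

Lemma exact0 X Y Z (f : 'Hom(X, Y)) (g : 'Hom(Y, Z)) x :
  limg f = lker g -> g (f x) = 0.
Proof.
by move=> E; apply/eqP; rewrite -memv_ker -E; apply/memv_limgP; exists x.
Qed.

(** The choice of the presentation is immaterial, by the argument of Schanuel's
    lemma: with lifts [s : P -> P'] and [t : P' -> P] of the identity of [M],
    the map [s t - 1] takes [P'] to [K'], and on [K'] the map [f] is the
    difference of [(f s) t] and [f (s t - 1)], both of which extend to [P']. *)
Lemma ext1_vanishesI M X (P K : rmod A) (p : 'Hom(P, M)) (i : 'Hom(K, P)) :
  projective P -> short_exact i p ->
  (forall f : 'Hom(K, X), is_hom f ->
    exists2 g : 'Hom(P, X), is_hom g & forall x, g (i x) = f x) ->
  ext1_vanishes M X.
Proof.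
move=> HP [Hi Hip Hp] H P' K' p' i' HP' [Hi' Hip' Hp'] f Hf.
have [Hih [Hph [Hih' Hph']]] : is_hom i /\ is_hom p /\ is_hom i' /\ is_hom p'.
  by case: Hi Hp Hi' Hp' => ? _ [? _] [? _] [? _].
have [s Hs sE] := projective_lift HP Hp' Hph.
have [t Ht tE] := projective_lift HP' Hp Hph'.
have [|u Hu uE] := lift_mono Hi' (is_hom_comp Hs Hih).
  by move=> z; rewrite Hip' memv_ker !comp_lfunE sE (exact0 _ Hip).
have [|v Hv vE] := lift_mono Hi' (is_homB (is_hom_comp Hs Ht) (@is_hom_id P')).
  move=> z; rewrite Hip' memv_ker add_lfunE opp_lfunE id_lfunE comp_lfunE.
  by rewrite linearB /= sE tE subrr.
have [g Hg gE] := H _ (is_hom_comp Hf Hu).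
exists ((g \o t) - (f \o v))%VF.
  by apply: is_homB; apply: is_hom_comp.
move=> x; rewrite add_lfunE opp_lfunE !comp_lfunE.
have [w wE] : exists w, i w = t (i' x).
  by apply: (exactP Hip); rewrite tE (exact0 _ Hip').
rewrite -wE gE comp_lfunE -linearB /=; congr (f _); apply: (mod_mono_inj Hi').
rewrite linearB /= uE vE add_lfunE opp_lfunE id_lfunE !comp_lfunE wE.
by rewrite opprB addrCA subrr addr0.
Qed.

End ModuleBasics.

(** * Minimal presentations, injective envelopes and transposes exist *)

Lemma nat_least (Q : nat -> Prop) :
  (exists n, Q n) -> exists n, Q n /\ forall m, Q m -> (n <= m)%N.
Proof.
move=> [n Qn]; apply: NNPP => H.
suff: forall m, (m < n.+1)%N -> ~ Q m by move=> /(_ n (ltnSn n)).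
elim: n.+1 => [|d IHd] // m; rewrite ltnS leq_eqVlt => /orP[/eqP->|/IHd //].
move=> Qd; apply: H; exists d; split=> // m' Qm'; rewrite leqNgt.
by apply/negP => /IHd.
Qed.

Section Existence.
Variables (k : fieldType) (A : falgType k).
Implicit Types M N P X Y Z : rmod A.

(** Fitting's lemma: a power of [h] of least rank restricts to an automorphism
    of its image, which is therefore a direct summand. *)
Lemma fitting P (h : 'End(P)) : is_hom h ->
  exists (n : nat) (Q : rmod A) (s : 'Hom(Q, P)) (r : 'Hom(P, Q)),
    [/\ is_hom s, is_hom r, forall x, r (s x) = x, (limg s <= limg h)%VS
      & forall x, iter n h x \in limg s].
Proof.
move=> Hh; pose H n : 'End(P) := iter n.+1 (fun g => (h \o g)%VF) \1%VF.
have HE n x : H n x = iter n.+1 h x.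
  rewrite /H; elim: n.+1 x => [|m IHm] x /=; first by rewrite id_lfunE.
  by rewrite comp_lfunE IHm.
have Hhom n : is_hom (H n).
  rewrite /H; elim: n.+1 => [|m IHm]; first exact: is_hom_id.
  exact: is_hom_comp.
have [_ [[n ->] Hmin]] := @nat_least (fun d => exists n, d = \dim (limg (H n)))
  (ex_intro _ _ (ex_intro _ 0%N erefl)).
have [L [i [p [Hi Hp iE pE]]]] := image_factor (Hhom n).
have U0 : (limg (H n) :&: lker (H n) = 0)%VS.
  apply/eqP; rewrite -dimv_eq0 -leqn0 -(leq_add2r (\dim (H n @: limg (H n)))).
  rewrite limg_ker_dim add0n -limg_comp.
  suff -> : (H n \o H n = H (n + n.+1)%N)%VF.
    by apply: Hmin; exists (n + n.+1)%N.
  by apply/lfunP => x; rewrite comp_lfunE !HE -iterD addSn.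
have Hih : is_hom i by case: Hi.
have Hph : is_hom p by case: Hp.
have b_mono : mod_mono (p \o i)%VF.
  apply: monoI => [|x]; first exact: is_hom_comp.
  rewrite comp_lfunE => pix; apply: (mono_ker Hi); apply/eqP.
  by rewrite -memv0 -U0 memv_cap -iE memv_ker -pE pix linear0 eqxx andbT;
    apply/memv_limgP; exists x.
have [|g Hg gE] := lift_mono b_mono (@is_hom_id k A L).
  move=> z; rewrite lker0_limgf ?memvf //.
  by case: b_mono => _ ->.
exists n.+1, L, i, (g \o p)%VF; split=> //.
- exact: is_hom_comp.
- move=> x; apply: (mod_mono_inj b_mono).
  by rewrite (comp_lfunE g p) gE id_lfunE comp_lfunE.
- rewrite iE; apply/subvP => _ /memv_limgP[x <-].
  by rewrite HE iterS; apply/memv_limgP; exists (iter n h x).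
- by move=> x; rewrite iE -HE; apply/memv_limgP; exists x.
Qed.

Lemma dim_mono M N (i : 'Hom(M, N)) : mod_mono i -> \dim (limg i) = \dim {:M}.
Proof. by case=> _ Hi; apply: limg_dim_eq; rewrite Hi capv0. Qed.

Lemma retract_mono P (Q : rmod A) (s : 'Hom(Q, P)) (r : 'Hom(P, Q)) :
  is_hom s -> (forall x, r (s x) = x) -> mod_mono s.
Proof.
move=> Hs rs; apply: monoI => // x sx.
by rewrite -[x]rs sx linear0.
Qed.

(** A projective of least dimension mapping onto [M] is a projective cover: a
    proper submodule still covering [M] would, by Fitting's lemma, yield a
    smaller projective. *)
Lemma projective_cover M : exists (P : rmod A) (p : 'Hom(P, M)),
  [/\ projective P, mod_epi p & superfluous (lker p)].
Proof.
pose Q d := exists (P : rmod A) (p : 'Hom(P, M)),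
  [/\ projective P, mod_epi p & \dim {:P} = d].
have [|d [[P [p [HP Hp dP]]] dmin]] := @nat_least Q.
  by have [P [p [HP Hp]]] := projective_epi_ex M; exists (\dim {:P}), P, p.
exists P, p; split=> // U HU pU; apply/eqP; rewrite eqEdim subvf /= leqNgt.
apply/negP => dU.
have [S [i [Hi iE]]] := submodule_ex HU.
have [Hih Hph] : is_hom i /\ is_hom p by case: Hi Hp => ? _ [].
have pi_epi : mod_epi (p \o i)%VF.
  apply: epiI => [|y]; first exact: is_hom_comp.
  have [x xE] := epi_surj y Hp.
  have /memv_addP[u uK [v]] : x \in (lker p + U)%VS by rewrite pU memvf.
  rewrite -iE => /memv_limgP[z zE] xuv; exists z.
  rewrite comp_lfunE zE -xE xuv linearD /=.
  by move: uK; rewrite memv_ker => /eqP ->; rewrite add0r.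
have [g Hg gE] := projective_lift HP pi_epi Hph.
have [n [P' [s [r [Hs Hr rs sh sn]]]]] := fitting (is_hom_comp Hih Hg).
have ph x : p ((i \o g)%VF x) = p x by rewrite comp_lfunE -[RHS]gE comp_lfunE.
have phn m x : p (iter m (i \o g)%VF x) = p x.
  by elim: m => //= m <-; rewrite ph.
suff: Q (\dim {:P'}).
  move=> /dmin; rewrite leqNgt => /negP; apply; rewrite -dP.
  apply: leq_ltn_trans dU; rewrite -(dim_mono (retract_mono Hs rs)).
  apply/dimvS/(subv_trans sh)/subvP => _ /memv_limgP[x <-].
  by rewrite comp_lfunE -iE; apply/memv_limgP; exists (g x).
exists P', (p \o s)%VF; split=> //; first exact: retract_projective rs.
apply: epiI => [|y]; first exact: is_hom_comp.
have [x <-] := epi_surj y Hp; rewrite -(phn n).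
by have /memv_limgP[z <-] := sn x; exists z; rewrite comp_lfunE.
Qed.

Lemma minimal_presentation_ex M : exists (P1 P0 : rmod A)
  (p1 : 'Hom(P1, P0)) (p0 : 'Hom(P0, M)), minimal_proj_presentation p1 p0.
Proof.
have [P0 [p0 [HP0 Hp0 sp0]]] := projective_cover M.
have Hp0h : is_hom p0 by case: Hp0.
have [K [i [Hi iE]]] := kernel_ex Hp0h.
have Hih : is_hom i by case: Hi.
have [P1 [q [HP1 Hq sq]]] := projective_cover K.
have Hqh : is_hom q by case: Hq.
exists P1, P0, (i \o q)%VF, p0; split; split=> //.
- exact: is_hom_comp.
- by rewrite limg_comp; case: Hq => _ ->.
- suff -> : lker (i \o q)%VF = lker q by [].
  apply/vspaceP => x; rewrite !memv_ker comp_lfunE.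
  by apply/eqP/eqP => [/(mono_ker Hi) // | ->]; rewrite linear0.
Qed.

Lemma retract_injective (I J : rmod A) (s : 'Hom(J, I)) (r : 'Hom(I, J)) :
  injective_mod I -> is_hom s -> is_hom r -> (forall x, r (s x) = x) ->
  injective_mod J.
Proof.
move=> HI Hs Hr rs X Y i f Hi Hf.
have [g Hg gE] := HI _ _ _ _ Hi (is_hom_comp Hs Hf).
exists (r \o g)%VF; first exact: is_hom_comp.
by apply/lfunP => x; rewrite -comp_lfunA -gE !comp_lfunE rs.
Qed.

Lemma injective_extend X Y (I : rmod A) (i : 'Hom(X, Y)) (f : 'Hom(X, I)) :
  injective_mod I -> mod_mono i -> is_hom f ->
  exists2 g : 'Hom(Y, I), is_hom g & forall x, g (i x) = f x.
Proof.
move=> HI Hi Hf; have [g Hg ->] := HI _ _ _ _ Hi Hf.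
by exists g => // x; rewrite comp_lfunE.
Qed.

End Existence.

(** ** Duality *)

Section Duality.
Variables (k : fieldType) (A : falgType k).
Implicit Types M X Y : rmod A.
Implicit Types P Q : rmod A^c.

Definition codual P : rmod A := rmod_cc (dual P).

Lemma dual_actE M (phi : 'Hom(M, k^o)) (a : A^c) x :
  (ract (dual M) phi a : 'Hom(M, k^o)) x = phi (ract M x a).
Proof. by rewrite /= comp_lfunE ract_lfunE. Qed.

Lemma codual_actE P (phi : 'Hom(P, k^o)) (a : A) x :
  (ract (codual P) phi a : 'Hom(P, k^o)) x = phi (ract P x a).
Proof. by rewrite /= comp_lfunE ract_lfunE. Qed.

Lemma to_codual X P (g : 'Hom(P, dual X)) : is_hom g ->
  exists2 h : 'Hom(X, codual P), is_hom h &
    forall x y, (h x : 'Hom(P, k^o)) y = (g y : 'Hom(X, k^o)) x.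
Proof.
move=> Hg; have [||h hE] := @bilinear_ex k X P k^o
    (fun x y => (g y : 'Hom(X, k^o)) x).
- by move=> y a u v; rewrite linearP.
- by move=> x a u v; rewrite linearP add_lfunE scale_lfunE.
exists h => // x a; apply/lfunP => y.
by rewrite hE codual_actE hE Hg dual_actE.
Qed.

Lemma to_dual X P (h : 'Hom(X, codual P)) : is_hom h ->
  exists2 g : 'Hom(P, dual X), is_hom g &
    forall x y, (g y : 'Hom(X, k^o)) x = (h x : 'Hom(P, k^o)) y.
Proof.
move=> Hh; have [||g gE] := @bilinear_ex k P X k^o
    (fun y x => (h x : 'Hom(P, k^o)) y).
- by move=> x a u v; rewrite linearP.
- by move=> y a u v; rewrite linearP add_lfunE scale_lfunE.
exists g => // y a; apply/lfunP => x.
by rewrite gE dual_actE gE Hh codual_actE.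
Qed.

(** An extension problem into [DP] transposes to a lifting problem from [P]
    along the epimorphism dual to the given monomorphism. *)
Lemma codual_injective P : projective P -> injective_mod (codual P).
Proof.
move=> HP X Y i f Hi Hf.
have Hih : is_hom i by case: Hi.
have [g Hg gE] := to_dual Hf.
have [|Di DiE] := @lfun_ex k (dual Y) (dual X)
    (fun phi : 'Hom(Y, k^o) => (phi \o i)%VF).
  by move=> a u v; rewrite comp_lfunDl comp_lfunZl.
have DiEE (phi : 'Hom(Y, k^o)) x : (Di phi : 'Hom(X, k^o)) x = phi (i x).
  by rewrite DiE comp_lfunE.
have Di_epi : mod_epi Di.
  apply: epiI => [phi a|phi].
    by apply/lfunP => x; rewrite DiEE !dual_actE DiEE Hih.
  exists ((phi : 'Hom(X, k^o)) \o i^-1)%VF; apply/lfunP => x.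
  rewrite DiEE comp_lfunE lker0_lfunK //.
  by case: Hi => _ ->.
have [G HG GE] := projective_lift HP Di_epi Hg.
have [F HF FE] := to_codual HG.
exists F => //; apply/lfunP => x; apply/lfunP => y.
by rewrite comp_lfunE FE -DiEE GE gE.
Qed.

Lemma codual_mono X P (g : 'Hom(P, dual X)) (h : 'Hom(X, codual P)) :
  mod_epi g -> is_hom h ->
  (forall x y, (h x : 'Hom(P, k^o)) y = (g y : 'Hom(X, k^o)) x) -> mod_mono h.
Proof.
move=> Hg Hh hE; apply: monoI => // x hx; apply: form_sep => phi.
have [y <-] := epi_surj (phi : dual X) Hg.
by rewrite -hE hx zero_lfunE.
Qed.

Lemma injective_hull_ex X : exists (I : rmod A) (i : 'Hom(X, I)),
  injective_mod I /\ mod_mono i.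
Proof.
have [P [p [HP Hp]]] := projective_epi_ex (dual X).
have [|h Hh hE] := @to_codual X P p; first by case: Hp.
exists (codual P), h; split; first exact: codual_injective.
exact: codual_mono hE.
Qed.

(** Dual to [projective_cover]: if [X] meets a nonzero submodule [V] of an
    injective [I] trivially, then [X] embeds in [I / V], and Fitting's lemma
    yields an injective of smaller dimension containing [X]. *)
Lemma injective_envelope_ex X : exists (I : rmod A) (i : 'Hom(X, I)),
  injective_envelope i.
Proof.
pose Q d := exists (I : rmod A) (i : 'Hom(X, I)),
  [/\ injective_mod I, mod_mono i & \dim {:I} = d].
have [|d [[I [i [HI Hi dI]]] dmin]] := @nat_least Q.
  by have [I [i [HI Hi]]] := injective_hull_ex X; exists (\dim {:I}), I, i.
exists I, i; split=> // V HV iV; apply/eqP; rewrite -dimv_eq0 -leqn0 leqNgt.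
apply/negP => dV.
have [R [q [Hq qE]]] := quotient_ex HV.
have [Hih Hqh] : is_hom i /\ is_hom q by case: Hi Hq => ? _ [].
have qi_mono : mod_mono (q \o i)%VF.
  apply: monoI => [|x]; first exact: is_hom_comp.
  rewrite comp_lfunE => qix; apply: (mono_ker Hi); apply/eqP.
  rewrite -memv0 -iV memv_cap -qE memv_ker qix eqxx andbT.
  by apply/memv_limgP; exists x.
have [g Hg gE] := injective_extend HI qi_mono Hih.
have [n [J [s [r [Hs Hr rs sh sn]]]]] := fitting (is_hom_comp Hg Hqh).
have hi x : (g \o q)%VF (i x) = i x by rewrite comp_lfunE -[RHS]gE comp_lfunE.
have hin m x : iter m (g \o q)%VF (i x) = i x.
  by elim: m => //= m ->; rewrite hi.
suff: Q (\dim {:J}).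
  move=> /dmin; rewrite leqNgt => /negP; apply; rewrite -dI.
  rewrite -(dim_mono (retract_mono Hs rs)).
  apply: leq_ltn_trans (dimvS sh) _.
  rewrite -(limg_ker_dim (g \o q)%VF {:I}) -[X in (X < _)%N]add0n ltn_add2r.
  apply: leq_trans dV (dimvS _); apply/subvP => v.
  by rewrite -qE capfv !memv_ker comp_lfunE => /eqP ->; rewrite linear0.
exists J, (r \o i)%VF; split=> //; first exact: retract_injective rs.
apply: monoI => [|x]; first exact: is_hom_comp.
rewrite comp_lfunE => rix; apply: (mono_ker Hi).
have /memv_limgP[z zE] := sn (i x); move: zE; rewrite hin => zE.
by rewrite -zE -[z]rs zE rix linear0.
Qed.

Lemma transpose_coker_ex (P1 P0 : rmod A) (p1 : 'Hom(P1, P0)) : is_hom p1 ->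
  exists (N : rmod A^c) (cls : 'Hom('Hom(P1, reg A), N)),
    [/\ forall y : N, exists2 f : 'Hom(P1, reg A), is_hom f & cls f = y,
        forall f : 'Hom(P1, reg A), is_hom f ->
          (cls f = 0 <->
           exists2 g : 'Hom(P0, reg A), is_hom g & f = (g \o p1)%VF)
      & forall (a : A) (f : 'Hom(P1, reg A)), is_hom f ->
          cls (amull a \o f)%VF = ract N (cls f) a].
Proof.
move=> Hp1; have [H HP] := hom_space P1 (reg A).
have lmul_hom (P : rmod A) a (f : 'Hom(P, reg A)) :
    is_hom f -> is_hom (lmul a \o f)%VF.
  by move=> Hf; apply: is_hom_comp => //; apply: is_hom_lmul.
have lmulfE a (f : 'Hom(P1, reg A)) x : (lmul a \o f)%VF x = a * f x.
  by rewrite comp_lfunE lmulE.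
pose act (f : subvs_of H) (a : A) : subvs_of H :=
  vsproj H (lmul a \o vsval f)%VF.
have actE f a x : vsval (act f a) x = a * vsval f x.
  rewrite vsprojK ?lmulfE //; apply/HP/lmul_hom/HP; exact: subvsP.
have vsvalP c (x y : subvs_of H) :
  vsval (c *: x + y) = c *: vsval x + vsval y by [].
have linl a : linear (act^~ a).
  move=> c f g; apply: subvs_inj; apply/lfunP => x.
  rewrite vsvalP add_lfunE scale_lfunE !actE vsvalP add_lfunE scale_lfunE.
  by rewrite mulrDr scalerAr.
have linr f : linear (act f).
  move=> c a b; apply: subvs_inj; apply/lfunP => x.
  by rewrite vsvalP add_lfunE scale_lfunE !actE mulrDl scalerAl.
have act1 f : act f 1 = f.
  by apply: subvs_inj; apply/lfunP => x; rewrite actE mul1r.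
have actM f (a b : A^c) : act f (a * b) = act (act f a) b.
  by apply: subvs_inj; apply/lfunP => x; rewrite !actE mulrA.
pose S : rmod A^c := @RMod k A^c (subvs_of H) act linl linr act1 actM.
have [||J JP] := @subspace_ex k S (fun f => exists2 g : 'Hom(P0, reg A),
    is_hom g & vsval (f : subvs_of H) = (g \o p1)%VF).
- exists 0; first exact: is_hom0.
  by rewrite comp_lfun0l.
- move=> c f f' [g Hg gE] [g' Hg' gE']; exists (c *: g + g').
    exact: is_hom_lin.
  by rewrite vsvalP gE gE' comp_lfunDl comp_lfunZl.
have [|N [q [Hq qE]]] := @quotient_ex k A^c S J.
  move=> f a /JP[g Hg gE]; apply/JP; exists (@lmul k A a \o g)%VF.
    exact: lmul_hom.
  by apply/lfunP => x; rewrite actE gE !comp_lfunE lmulE.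
have Hqh : is_hom q by case: Hq.
pose pr : 'Hom('Hom(P1, reg A), S) := linfun (vsproj H).
have prE f : is_hom f -> vsval (pr f : subvs_of H) = f.
  by move=> /HP Hf; rewrite lfunE /= vsprojK.
exists N, (q \o pr)%VF; split.
- move=> y; have [f fE] := epi_surj y Hq; exists (vsval (f : subvs_of H)).
    by apply/HP; apply: subvsP.
  rewrite comp_lfunE -fE; congr (q _).
  by apply: subvs_inj; rewrite prE //; apply/HP; apply: subvsP.
- move=> f Hf; rewrite comp_lfunE; apply: (iff_trans (B := pr f \in J)).
    by rewrite -qE memv_ker; split=> [->|/eqP].
  by rewrite -{2}(prE f Hf); apply: JP.
- move=> a f Hf; rewrite !comp_lfunE -Hqh; congr (q _).
  apply: subvs_inj; rewrite prE; last exact: lmul_hom.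
  by apply/lfunP => x; rewrite actE prE // lmulfE.
Qed.

End Duality.

(** * Rigidity and first extension groups *)

Section Transpose.
Variables (k : fieldType) (A : falgType k).
Variables (P1 P0 : rmod A) (p1 : 'Hom(P1, P0)) (T : rmod A^c).
Variable cls : 'Hom('Hom(P1, reg A), T).
Hypotheses (projP1 : projective P1) (projP0 : projective P0).
Hypothesis p1_hom : is_hom p1.
Hypothesis cls_surj :
  forall y : T, exists2 f : 'Hom(P1, reg A), is_hom f & cls f = y.
Hypothesis cls_ker : forall f : 'Hom(P1, reg A), is_hom f ->
  (cls f = 0 <-> exists2 g : 'Hom(P0, reg A), is_hom g & f = (g \o p1)%VF).
Hypothesis cls_act : forall (a : A) (f : 'Hom(P1, reg A)), is_hom f ->
  cls (amull a \o f)%VF = ract T (cls f) a.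

Let cls_lmul (a : A) (f : 'Hom(P1, reg A)) :
  is_hom f -> cls (lmul a \o f)%VF = ract T (cls f) a.
Proof. exact: cls_act. Qed.

Let cls_expand n (x : 'I_n -> P1) phi : dual_basis x phi ->
  forall f : 'Hom(P1, reg A), is_hom f ->
    cls f = \sum_i ract T (cls (phi i)) (f (x i)).
Proof.
case=> Hphi Hx f Hf; rewrite {1}(_ : f = \sum_i (lmul (f (x i)) \o phi i)%VF).
  by rewrite linear_sum; apply: eq_bigr => i _; apply: cls_lmul.
apply/lfunP => y; rewrite sum_lfunE {1}(Hx y) linear_sum.
by apply: eq_bigr => i _; rewrite /= comp_lfunE Hf lmulE.
Qed.

(** [Hom(N, D Tr M)] is the dual of [N (x) Tr M], that is, of the cokernel of
    [Hom(P0, N) -> Hom(P1, N)]. Dual bases of [P1] and [P0] express all maps to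
    [N] by maps to [A], which makes the pairing explicit. *)
Lemma hom_zero_dual_transpose (N : rmod A) :
  hom_zero N (codual T) <->
  forall f : 'Hom(P1, N), is_hom f ->
    exists2 g : 'Hom(P0, N), is_hom g & forall x, g (p1 x) = f x.
Proof.
have [m [x [phi B1]]] := projective_dual_basis projP1.
have [n [y [chi B0]]] := projective_dual_basis projP0.
have [Hphi Hx] := B1; have [Hchi Hy] := B0.
split=> [zero f Hf | ext h Hh].
- have [J JP] : exists J : {vspace 'Hom(P1, N)}, forall f, f \in J <->
      exists2 g : 'Hom(P0, N), is_hom g & f = (g \o p1)%VF.
    apply: subspace_ex => [|a f1 f2 [g1 H1 E1] [g2 H2 E2]].
      by exists 0; [exact: is_hom0 | rewrite comp_lfun0l].
    exists (a *: g1 + g2); first exact: is_hom_lin.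
    by rewrite E1 E2 comp_lfunDl comp_lfunZl.
  suff: f \in J.
    by move=> /JP[g Hg ->]; exists g => // z; rewrite comp_lfunE.
  apply: contraT => /separating_form[Phi [Phif PhiJ]].
  have [H HP] := hom_space P1 (reg A).
  have [|s sP] := @linear_section k _ _ H cls.
    by move=> t; have [g /HP Hg gt] := cls_surj t; exists g.
  have sH t : is_hom (s t) by apply/HP; case: (sP t).
  have sK t : cls (s t) = t by case: (sP t).
  have PhiE u g : is_hom g ->
      Phi (orbit_map u \o s (cls g))%VF = Phi (orbit_map u \o g)%VF.
    move=> Hg; apply/eqP; rewrite -subr_eq0 -linearB /=; apply/eqP/PhiJ/JP.
    have [|w Hw wE] := proj1 (cls_ker (is_homB (sH (cls g)) Hg)).
      by rewrite linearB /= sK subrr.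
    exists (orbit_map u \o w)%VF; first exact: is_hom_comp (is_hom_orbit u) Hw.
    by rewrite -comp_lfunA -wE comp_lfunDr comp_lfunNr.
  have [||h hE] := @bilinear_ex k N T k^o
    (fun u t => Phi (orbit_map u \o s t)%VF).
  + by move=> t c u v; rewrite orbit_map_lin comp_lfunDl -comp_lfunZl linearP.
  + by move=> u c t t'; rewrite linearP comp_lfunDr -comp_lfunZr linearP.
  have Hh : is_hom (h : 'Hom(N, codual T)).
    move=> u a; apply/lfunP => t.
    rewrite codual_actE !hE -{2}(sK t) -cls_lmul //.
    rewrite PhiE; last exact: is_hom_comp (is_hom_lmul a) (sH t).
    congr (Phi _); apply/lfunP => z.
    by rewrite !comp_lfunE !orbit_mapE -ractM.
  suff: Phi f = 0 by rewrite Phif => /eqP; rewrite oner_eq0.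
  rewrite (_ : f = \sum_i (orbit_map (f (x i)) \o phi i)%VF).
    rewrite linear_sum big1 //= => i _; rewrite -PhiE // -hE.
    by rewrite (zero _ Hh) !zero_lfunE.
  apply/lfunP => z; rewrite sum_lfunE {1}(Hx z) linear_sum.
  by apply: eq_bigr => i _; rewrite /= comp_lfunE Hf orbit_mapE.
- apply/lfunP => u; apply/lfunP => t; rewrite !zero_lfunE.
  have hact v a t' : (h (ract N v a) : 'Hom(T, k^o)) t' =
      (h v : 'Hom(T, k^o)) (ract T t' a).
    by rewrite Hh codual_actE.
  have [f Hf <-] := cls_surj t.
  have [|g Hg gE] := ext (orbit_map u \o f)%VF.
    exact: is_hom_comp (is_hom_orbit u) Hf.
  rewrite (cls_expand B1 Hf) linear_sum /=.
  transitivity (\sum_j (h (g (y j)) : 'Hom(T, k^o)) (cls (chi j \o p1)%VF));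
    last first.
    apply: big1 => j _; rewrite (proj2 (cls_ker _)) ?linear0 //.
      exact: is_hom_comp (Hchi j) p1_hom.
    by exists (chi j).
  transitivity (\sum_j \sum_i (h (g (y j)) : 'Hom(T, k^o))
      (ract T (cls (phi i)) (chi j (p1 (x i))))); last first.
    apply: eq_bigr => j _.
    rewrite (cls_expand B1 (is_hom_comp (Hchi j) p1_hom)).
    by rewrite linear_sum; apply: eq_bigr => i _; rewrite comp_lfunE.
  rewrite exchange_big; apply: eq_bigr => i _ /=.
  rewrite -hact -[ract N u _]orbit_mapE -[X in h X]comp_lfunE -gE.
  rewrite [in LHS](Hy (p1 (x i))).
  rewrite !linear_sum sum_lfunE; apply: eq_bigr => j _.
  by rewrite /= Hg hact.
Qed.

End Transpose.

Section Rigidity.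
Variables (k : fieldType) (A : falgType k).
Implicit Types M N X : rmod A.

Lemma Gen_quotient M X (q : 'Hom(M, X)) : mod_epi q -> in_Gen M X.
Proof.
move=> Hq; exists 1%N, M, q; split=> //.
exists (fun=> \1%VF), (fun=> \1%VF); split=> //.
- by move=> _; apply: is_hom_id.
- by move=> _; apply: is_hom_id.
- by move=> _; rewrite comp_lfun1l.
- by move=> i j; rewrite !ord1 eqxx.
- by rewrite big_ord1 comp_lfun1l.
Qed.

Lemma mod_iso_refl M : mod_iso M M.
Proof.
exists \1%VF; split.
  by apply: monoI => [|x]; [apply: is_hom_id | rewrite id_lfunE].
apply: epiI => [|y]; first exact: is_hom_id.
by exists y; rewrite id_lfunE.
Qed.

Lemma hom_zero_iso M N N' : mod_iso N N' -> hom_zero M N' -> hom_zero M N.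
Proof.
move=> [f [fmono fepi]] zero g Hg; apply/lfunP => x; rewrite zero_lfunE.
apply: (mono_ker fmono); have [fh _] := fmono.
by rewrite -comp_lfunE (zero _ (is_hom_comp fh Hg)) zero_lfunE.
Qed.

Section Presentation.
Variables (M P1 P0 K : rmod A).
Variables (p1 : 'Hom(P1, P0)) (p0 : 'Hom(P0, M)) (i : 'Hom(K, P0)).
Hypotheses (HP1 : projective P1) (HP0 : projective P0).
Hypotheses (Hp1 : is_hom p1) (Hp0 : mod_epi p0) (p10 : limg p1 = lker p0).
Hypotheses (Hi : mod_mono i) (ip0 : limg i = lker p0).

Lemma presentation_factor :
  exists2 q : 'Hom(P1, K), mod_epi q & forall x, i (q x) = p1 x.
Proof.
have [|q Hq qE] := lift_mono Hi Hp1.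
  by move=> z; rewrite ip0 -p10; apply/memv_limgP; exists z.
exists q => //; apply: epiI => // y.
have [|x xE] := @exactP _ _ _ _ _ _ _ (i y) p10; first exact: exact0.
by exists x; apply: (mod_mono_inj Hi); rewrite qE.
Qed.

Lemma ext1_of_factorization X :
  (forall f : 'Hom(P1, M), is_hom f ->
     exists2 g : 'Hom(P0, M), is_hom g & forall x, g (p1 x) = f x) ->
  in_Gen M X -> ext1_vanishes M X.
Proof.
move=> ext [d [Md [p [[inj [pr [Hinj Hpr _ _ sum1]]] Hp]]]].
have Hph : is_hom p by case: Hp.
apply: (ext1_vanishesI HP0 (And3 Hi ip0 Hp0)) => f Hf.
have [q Hq qE] := presentation_factor; have Hqh : is_hom q by case: Hq.
have [F HF FE] := projective_lift HP1 Hp (is_hom_comp Hf Hqh).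
have /fin_all_exists[g gP] (j : 'I_d) : exists g : 'Hom(P0, M),
    is_hom g /\ forall x, g (p1 x) = pr j (F x).
  have [g Hg gE] := ext _ (is_hom_comp (Hpr j) HF).
  by exists g; split=> // x; rewrite gE comp_lfunE.
exists (p \o \sum_j (inj j \o g j))%VF.
  apply: is_hom_comp => //; apply: is_hom_sum => j.
  by apply: is_hom_comp => //; case: (gP j).
move=> y; have [x <-] := epi_surj y Hq; rewrite qE.
rewrite -[f (q x)]comp_lfunE -FE comp_lfunE sum_lfunE; congr (p _).
rewrite -[RHS]id_lfunE -sum1 sum_lfunE; apply: eq_bigr => j _.
by rewrite !comp_lfunE (proj2 (gP j)).
Qed.

(** Modulo the image of [Ker p1] in [M] the map [f] extends to [P0]. Its
    difference with a lift of that extension attains all its values on the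
    superfluous submodule [Ker p1], and hence vanishes. *)
Lemma factorization_of_ext1 : superfluous (lker p1) ->
  (forall X, in_Gen M X -> ext1_vanishes M X) ->
  forall f : 'Hom(P1, M), is_hom f ->
    exists2 g : 'Hom(P0, M), is_hom g & forall x, g (p1 x) = f x.
Proof.
move=> sup ext f Hf.
have [|X [q [Hq qU]]] := @quotient_ex k A M (f @: lker p1)%VS.
  move=> _ a /memv_imgP[x xK ->]; rewrite -Hf memv_img //.
  exact: is_submod_ker.
have q0 x : (q x == 0) = (x \in (f @: lker p1)%VS) by rewrite -memv_ker qU.
have Hqh : is_hom q by case: Hq.
have [r Hr rE] := presentation_factor.
have [|f' Hf' f'E] := factor_epi Hr (is_hom_comp Hqh Hf).
  move=> x rx; apply/eqP; rewrite comp_lfunE q0 memv_img // memv_ker.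
  by rewrite -rE rx linear0.
have [g' Hg' g'E] :=
  ext _ (Gen_quotient Hq) _ _ _ _ HP0 (And3 Hi ip0 Hp0) _ Hf'.
have [g Hg gE] := projective_lift HP0 Hq Hg'.
have He := is_homB Hf (is_hom_comp Hg Hp1).
pose e : 'Hom(P1, M) := f - (g \o p1)%VF.
have eE x : e x = f x - g (p1 x) by rewrite add_lfunE opp_lfunE comp_lfunE.
suff eU : lker e = fullv.
  exists g => // x; apply/eqP; rewrite eq_sym -subr_eq0 -eE -memv_ker eU.
  exact: memvf.
apply: sup; first exact: is_submod_ker.
apply/vspaceP => x; rewrite memvf.
have : q (e x) == 0.
  by rewrite eE linearB /= gE -rE g'E f'E comp_lfunE subrr.
rewrite q0 => /memv_imgP[z zK exz].
rewrite -[x](subrK z) addrC memv_add // memv_ker linearB /= exz [X in _ - X]eE.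
by move: zK; rewrite memv_ker => /eqP ->; rewrite linear0 subr0 subrr.
Qed.

End Presentation.

(** This criterion is due to Auslander and Smalo. *)
Lemma tau_rigid_ext1 M :
  tau_rigid M <-> forall X, in_Gen M X -> ext1_vanishes M X.
Proof.
split=> [rig X | ext N [T [P1 [P0 [p1 [p0 [cls [minp]]]]]]]].
- have [P1 [P0 [p1 [p0 minp]]]] := minimal_presentation_ex M.
  have [[HP0 Hp0 _] [HP1 Hp1 p10 _]] := minp.
  have Hp0h : is_hom p0 by case: Hp0.
  have [K [i [Hi ip0]]] := kernel_ex Hp0h.
  have [T [cls [surj ker act]]] := transpose_coker_ex Hp1.
  apply: (ext1_of_factorization HP1 HP0 Hp1 Hp0 p10 Hi ip0).
  apply/(hom_zero_dual_transpose HP1 HP0 Hp1 surj ker act)/rig.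
  exists T; last exact: mod_iso_refl.
  by exists P1, P0, p1, p0, cls.
- move=> surj ker act /hom_zero_iso; apply.
  have [[HP0 Hp0 _] [HP1 Hp1 p10 s1]] := minp.
  apply/(hom_zero_dual_transpose HP1 HP0 Hp1 surj ker act).
  have Hp0h : is_hom p0 by case: Hp0.
  have [K [i [Hi ip0]]] := kernel_ex Hp0h.
  exact: (factorization_of_ext1 HP0 Hp1 Hp0 p10 Hi ip0).
Qed.

End Rigidity.

(** * The global dimension of a tilted algebra *)

Section Hereditary.
Variables (k : fieldType) (A : falgType k).
Implicit Types M N X Y : rmod A.

Lemma zero_module_ex : exists Z : rmod A, forall x : Z, x = 0.
Proof. by exists (pow (reg A) 0) => x; apply/ffunP => -[]. Qed.

(** A presentation of length one is completed by zero modules to a projective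
    resolution. *)
Lemma ext1_vanishes_of_ext_zero M X :
  pd_le1 M -> ext_zero 1 M X -> ext1_vanishes M X.
Proof.
move=> [P1 [P0 [p1 [p0 [HP1 HP0 se]]]]] ext0.
have [Hp1 p10 Hp0] := se.
have [Z Z0] := zero_module_ex.
pose F n : rmod A := match n with 0 => P0 | 1 => P1 | _ => Z end.
pose d n : 'Hom(F n.+1, F n) := match n with
  | 0 => p1 | m.+1 => (0 : 'Hom(F m.+2, F m.+1)) end.
have Fproj n : projective (F n).
  case: n => [|[|n]] //= U V p f Hp Hf; exists 0; first exact: is_hom0.
  by apply/lfunP => x; rewrite [x]Z0 !linear0.
have d_hom n : is_hom (d n).
  by case: n => [|n]; [case: Hp1 | apply: is_hom0].
have dex n : limg (d n.+1) = lker (d n).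
  rewrite lim0g; case: n => [|n]; first by case: Hp1.
  by apply/vspaceP => x; rewrite [x]Z0 !mem0v.
pose R := @ProjResolution k A M F d p0 Fproj d_hom Hp0 p10 dex.
apply: (ext1_vanishesI HP0 se) => f Hf.
have [|g Hg gE] := ext0 R f; first by split; rewrite ?comp_lfun0r.
by exists g => // x; rewrite gE comp_lfunE.
Qed.

Lemma pow_injections M n : exists s : 'I_n -> 'Hom(M, pow M n),
  (forall l, is_hom (s l)) /\ forall w, w = \sum_l s l (component w l).
Proof.
have /fin_all_exists[s sP] (l : 'I_n) : exists s : 'Hom(M, pow M n),
    is_hom s /\ forall x j, component (s x) j = if j == l then x else 0.
  have [|f Hf fE] := @pow_pair k A M n M
    (fun j => if j == l then \1%VF else 0).
    by move=> j; case: eqP => _; [apply: is_hom_id | apply: is_hom0].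
  exists f; split=> // x j; rewrite fE.
  by case: eqP => _; rewrite ?id_lfunE ?zero_lfunE.
exists s; split=> [l | w]; first by case: (sP l).
apply/ffunP => j; rewrite sum_ffunE (bigD1 j) //= big1 => [|l lj].
  by rewrite -/(component _ _) (proj2 (sP j)) eqxx addr0.
by rewrite -/(component _ _) (proj2 (sP l)) eq_sym (negPf lj).
Qed.

Lemma pow_map M N n (f : 'Hom(M, N)) : is_hom f ->
  exists2 g : 'Hom(pow M n, pow N n), is_hom g &
    forall x j, component (g x) j = f (component x j).
Proof.
move=> Hf; have /fin_all_exists[pr prP] (j : 'I_n) :
    exists pr : 'Hom(pow M n, M), is_hom pr /\ forall x, pr x = component x j.
  by have [pr] := pow_proj M j; exists pr.
have [|g Hg gE] := @pow_pair k A N n (pow M n) (fun j => (f \o pr j)%VF).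
  by move=> j; apply: is_hom_comp => //; case: (prP j).
by exists g => // x j; rewrite gE comp_lfunE (proj2 (prP j)).
Qed.

Lemma pow_projective M n : projective M -> projective (pow M n).
Proof.
move=> HM X Y p f Hp Hf; have [s [Hs sE]] := pow_injections M n.
have /fin_all_exists[g gP] (l : 'I_n) : exists g : 'Hom(M, X),
    is_hom g /\ forall x, p (g x) = f (s l x).
  have [g Hg gE] := projective_lift HM Hp (is_hom_comp Hf (Hs l)).
  by exists g; split=> // x; rewrite gE comp_lfunE.
have [|G HG GE] := @pow_copair k A M n X g; first by move=> l; case: (gP l).
exists G => //; apply/lfunP => w; rewrite comp_lfunE GE {1}(sE w) !linear_sum.
by apply: eq_bigr => l _; rewrite /= (proj2 (gP l)).
Qed.

Lemma ext1_vanishes_pow M X n : ext1_vanishes M X -> ext1_vanishes (pow M n) X.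
Proof.
move=> ext; have [P [p [HP Hp]]] := projective_epi_ex M.
have Hph : is_hom p by case: Hp.
have [K [i [Hi ip]]] := kernel_ex Hph; have Hih : is_hom i by case: Hi.
have [pn Hpn pnE] := pow_map n Hph; have [im Him imE] := pow_map n Hih.
have se : short_exact im pn.
  split.
  - apply: monoI => // x x0; apply/ffunP => j; rewrite ffunE.
    by apply: (mono_ker Hi); rewrite -imE x0 /component ffunE.
  - apply/vspaceP => x; rewrite memv_ker.
    apply/idP/eqP => [/memv_limgP[y <-]|x0].
      by apply/ffunP => j; rewrite [LHS]pnE imE ffunE (exact0 _ ip).
    have /fin_all_exists[y yE] (j : 'I_n) : exists y, i y = component x j.
      by apply: (exactP ip); rewrite -pnE x0 /component ffunE.
    apply/memv_limgP; exists ([ffun j => y j] : {ffun 'I_n -> K}).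
    by apply/ffunP => j; rewrite [LHS]imE ffunE yE.
  - apply: epiI => // y.
    have /fin_all_exists[x xE] (j : 'I_n) : exists x, p x = component y j.
      exact: epi_surj.
    exists ([ffun j => x j] : {ffun 'I_n -> P}).
    by apply/ffunP => j; rewrite [LHS]pnE ffunE xE.
apply: (ext1_vanishesI (pow_projective (n := n) HP) se) => f Hf.
have [t [Ht tE]] := pow_injections K n.
have /fin_all_exists[g gP] (l : 'I_n) : exists g : 'Hom(P, X),
    is_hom g /\ forall x, g (i x) = f (t l x).
  have [g Hg gE] := ext _ _ _ _ HP (And3 Hi ip Hp) _ (is_hom_comp Hf (Ht l)).
  by exists g; split=> // x; rewrite gE comp_lfunE.
have [|G HG GE] := @pow_copair k A P n X g; first by move=> l; case: (gP l).
exists G => // w; rewrite GE [in RHS](tE w) linear_sum.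
by apply: eq_bigr => l _; rewrite /= imE (proj2 (gP l)).
Qed.

(** [Ext^1(T, Ker p)] vanishes since [T] is rigid and all maps from [T] to [L]
    lift along [p]. Since [A] is hereditary, [Ext^2] vanishes and [Ext^1(L, -)]
    is a quotient of [Ext^1(T^m, -)]; so [Ext^1(L, Ker p)] vanishes too. *)
Lemma trace_splits (T L : rmod A) m d
    (i : 'Hom(L, pow T m)) (p : 'Hom(pow T d, L)) :
  @hereditary k A -> ext1_vanishes T T -> mod_mono i -> mod_epi p ->
  (forall g : 'Hom(T, L), is_hom g ->
     exists2 h : 'Hom(T, pow T d), is_hom h & forall t, p (h t) = g t) ->
  exists2 s : 'Hom(L, pow T d), is_hom s & forall u, p (s u) = u.
Proof.
move=> hered extT Hi Hp lifts.
have Hph : is_hom p by case: Hp.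
have Hih : is_hom i by case: Hi.
have [K [j [Hj jp]]] := kernel_ex Hph.
have Hjh : is_hom j by case: Hj.
have extK : ext1_vanishes T K.
  have [Q0 [q [HQ0 Hq]]] := projective_epi_ex T.
  have Hqh : is_hom q by case: Hq.
  have [Q1 [r [Hr rq]]] := kernel_ex Hqh.
  apply: (ext1_vanishesI HQ0 (And3 Hr rq Hq)) => f Hf.
  have /fin_all_exists[h_ h_P] (l : 'I_d) : exists h : 'Hom(Q0, T),
      is_hom h /\ forall x, h (r x) = component (j (f x)) l.
    have [pr Hpr prE] := pow_proj T l.
    have [h Hh hE] := extT _ _ _ _ HQ0 (And3 Hr rq Hq) _
      (is_hom_comp Hpr (is_hom_comp Hjh Hf)).
    by exists h; split=> // x; rewrite hE !comp_lfunE prE.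
  have [|h Hh hE] := @pow_pair k A T d Q0 h_; first by move=> l; case: (h_P l).
  have hr x : h (r x) = j (f x).
    by apply/ffunP => l; rewrite [LHS]hE (proj2 (h_P l)).
  have [|g Hg gE] := factor_epi Hq (is_hom_comp Hph Hh).
    move=> x /(exactP rq)[y <-]; rewrite comp_lfunE hr; exact: exact0.
  have [c Hc cE] := lifts g Hg.
  have [|w Hw wE] := lift_mono Hj (is_homB Hh (is_hom_comp Hc Hqh)).
    move=> z; rewrite jp memv_ker add_lfunE opp_lfunE comp_lfunE linearB /=.
    by rewrite cE gE comp_lfunE subrr.
  exists w => // x; apply: (mod_mono_inj Hj); rewrite wE add_lfunE opp_lfunE.
  by rewrite comp_lfunE hr (exact0 _ rq) linear0 subr0.
have extTm := ext1_vanishes_pow (n := m) extK.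
have [P [c [HP Hc]]] := projective_epi_ex (pow T m).
have Hch : is_hom c by case: Hc.
have [N [n [Hn nc]]] := kernel_ex Hch; have Hnh : is_hom n by case: Hn.
(* [S] is the inverse image of [L] in a projective [P] covering [pow T m]. *)
have [|S [s [Hs sE]]] := @submodule_ex k A P (c @^-1: limg i)%VS.
  move=> x a; rewrite -!memv_preim Hch; exact: is_submod_img.
have Hsh : is_hom s by case: Hs.
have sP x : c x \in limg i <-> exists y, s y = x.
  by rewrite memv_preim -sE; apply: memv_limgP.
have [|c' Hc' c'E] := lift_mono Hi (is_hom_comp Hch Hsh).
  by move=> z; rewrite comp_lfunE; apply/sP; exists z.
have c'_epi : mod_epi c'.
  apply: epiI => // u; have [x xE] := epi_surj (i u) Hc.
  have /sP[y yE] : c x \in limg i by rewrite xE; apply/memv_limgP; exists u.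
  by exists y; apply: (mod_mono_inj Hi); rewrite c'E comp_lfunE yE.
have [G HG GE] := projective_lift (hered _ _ _ HP Hs) Hp Hc'.
have [|u Hu uE] := lift_mono Hs Hnh.
  by move=> z; apply/memv_limgP/sP; rewrite (exact0 _ nc) mem0v.
have c'u x : c' (u x) = 0.
  by apply: (mono_ker Hi); rewrite c'E comp_lfunE uE (exact0 _ nc).
have [|w Hw wE] := lift_mono Hj (is_hom_comp HG Hu).
  by move=> x; rewrite jp memv_ker comp_lfunE GE c'u.
have [w' Hw' w'E] := extTm _ _ _ _ HP (And3 Hn nc Hc) _ Hw.
have HG' := is_homB HG (is_hom_comp Hjh (is_hom_comp Hw' Hsh)).
have [|t Ht tE] := factor_epi c'_epi HG'.
  move=> z c'z; have [x xE] : exists x, n x = s z.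
    by apply: (exactP nc); rewrite -comp_lfunE -c'E c'z linear0.
  have -> : z = u x by apply: (mod_mono_inj Hs); rewrite uE xE.
  by rewrite add_lfunE opp_lfunE !comp_lfunE uE w'E wE comp_lfunE subrr.
exists t => // y; have [z <-] := epi_surj y c'_epi.
rewrite tE add_lfunE opp_lfunE !comp_lfunE linearB /= GE.
by rewrite (exact0 _ jp) subr0.
Qed.

End Hereditary.

Section EndomorphismAlgebra.
Variables (k : fieldType) (A C : falgType k) (T : rmod A).
Hypotheses (hered : hereditary A) (rigidT : ext1_vanishes T T).
Variable phi : 'Hom(C, 'End(T)).
Hypotheses (phi_ker : lker phi = 0%VS)
  (phi_img : forall h : 'End(T), is_hom h <-> exists c, phi c = h)
  (phiM : forall c d, phi (c * d) = (phi c \o phi d)%VF).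

Let phi_hom c : is_hom (phi c).
Proof. by apply/phi_img; exists c. Qed.

Let phi_ext c d : (forall t, phi c t = phi d t) -> c = d.
Proof.
move=> H; have /lker0P inj : lker phi == 0%VS by rewrite phi_ker.
by apply: inj; apply/lfunP.
Qed.

Let phiME c d t : phi (c * d) t = phi c (phi d t).
Proof. by rewrite phiM comp_lfunE. Qed.

Let phi_sum n (c : 'I_n -> C) t : phi (\sum_l c l) t = \sum_l phi (c l) t.
Proof. by rewrite linear_sum sum_lfunE. Qed.

(** An element [v] of a projective [P1] with a dual basis [x], [u] of length [m]
    is a map [hat v : T -> T^m] with components [u_j v]. Let [L] be the sum of
    the images of the maps [hat v] for [v] in [K]. As [K] is the kernel of a map
    to a projective, any map [T -> L] is some [hat v] with [v] in [K]. Hence the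
    epimorphism from a power of [T] onto [L] splits, and the components of a
    splitting are the forms of a dual basis of [K]. *)
Lemma kernel_projective (P1 P0 K : rmod C)
    (f : 'Hom(P1, P0)) (i : 'Hom(K, P1)) :
  projective P1 -> projective P0 -> is_hom f -> mod_mono i -> limg i = lker f ->
  projective K.
Proof.
move=> HP1 HP0 Hf Hi iK; have Hih : is_hom i by case: Hi.
have [m [x [u [Hu ux]]]] := projective_dual_basis HP1.
have [n [y [w [Hw wy]]]] := projective_dual_basis HP0.
have [||hat hatE] := @bilinear_ex k P1 T (pow T m)
    (fun v t => [ffun j => phi (u j v) t] : {ffun 'I_m -> T}).
- move=> t a v v'; apply/ffunP => j.
  by rewrite !ffunE !linearP add_lfunE scale_lfunE.
- by move=> v a t t'; apply/ffunP => j; rewrite !ffunE linearP.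
have hat_comp v t j : component (hat v t) j = phi (u j v) t.
  by rewrite hatE /component ffunE.
have hat_hom v : is_hom (hat v).
  move=> t a; apply/ffunP => j.
  by rewrite [LHS]hat_comp phi_hom ffunE -hat_comp.
have hatM v c t : hat (ract P1 v c) t = hat v (phi c t).
  by apply/ffunP => j; rewrite [LHS]hat_comp [RHS]hat_comp Hu phiME.
pose d := \dim {:K}; pose b (l : 'I_d) : K := (vbasis {:K})`_l.
have bE v : v = \sum_l coord (vbasis {:K}) l v *: b l.
  exact: coord_vbasis (memvf v).
have [|e He eE] := @pow_copair k A T d (pow T m) (fun l => hat (i (b l))).
  by move=> l; apply: hat_hom.
have e_comp z j :
    component (e z) j = \sum_l phi (u j (i (b l))) (component z l).
  rewrite eE /component sum_ffunE; apply: eq_bigr => l _.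
  by rewrite -/(component _ _) hat_comp.
have [L [j [p [Hj Hp jL jp]]]] := image_factor He.
have Hjh : is_hom j by case: Hj.
have Hph : is_hom p by case: Hp.
have hat_L v t : hat (i v) t =
    e ([ffun l => coord (vbasis {:K}) l v *: t] : {ffun 'I_d -> T}).
  rewrite eE {1}(bE v) !linear_sum sum_lfunE; apply: eq_bigr => l _.
  by rewrite /component ffunE /= !linearZ /= scale_lfunE.
(* The components of a map [T -> L] are the coefficients of an element of [P1]
   on which homomorphisms [chi] to [C] are known from their values on [K]. *)
have descend (g : 'Hom(T, L)) : is_hom g -> exists v : P1,
    forall chi : 'Hom(P1, reg C), is_hom chi -> forall t z, j (g t) = e z ->
      phi (chi v) t = \sum_l phi (chi (i (b l))) (component z l).
  move=> Hg; have /fin_all_exists[c cE] (s : 'I_m) : exists c,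
      forall t, phi c t = component (j (g t)) s.
    have [pr Hpr prE] := pow_proj T s.
    have [c cE] := proj1 (phi_img _) (is_hom_comp Hpr (is_hom_comp Hjh Hg)).
    by exists c => t; rewrite cE !comp_lfunE prE.
  exists (\sum_s ract P1 (x s) (c s)) => chi Hchi t z jz.
  rewrite linear_sum phi_sum.
  transitivity
    (\sum_s \sum_l phi (chi (x s)) (phi (u s (i (b l))) (component z l))).
    apply: eq_bigr => s _; rewrite /= Hchi phiME cE jz e_comp linear_sum.
    by apply: eq_bigr.
  rewrite exchange_big; apply: eq_bigr => l _ /=.
  rewrite {2}(ux (i (b l))) linear_sum phi_sum; apply: eq_bigr => s _.
  by rewrite /= Hchi phiME.
have lifts (g : 'Hom(T, L)) : is_hom g ->
    exists2 h : 'Hom(T, pow T d), is_hom h & forall t, p (h t) = g t.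
  move=> Hg; have [v vE] := descend g Hg.
  have ex_z t : exists z, j (g t) = e z.
    have [z zE] := epi_surj (g t) Hp.
    by exists z; rewrite -jp zE.
  have fv : f v = 0.
    rewrite (wy (f v)) big1 // => s _.
    rewrite (_ : w s (f v) = 0) ?ract0r //; apply: phi_ext => t.
    have [z zE] := ex_z t.
    rewrite -comp_lfunE (vE _ (is_hom_comp (Hw s) Hf) t z zE) big1 => [|l _].
      by rewrite linear0 zero_lfunE.
    by rewrite comp_lfunE (exact0 _ iK) linear0 linear0 zero_lfunE.
  have [v' v'E] := exactP iK fv.
  have [|h Hh hE] := @pow_pair k A T d T
    (fun l => coord (vbasis {:K}) l v' *: \1%VF).
    by move=> l t a; rewrite !scale_lfunE !id_lfunE ractZl.
  exists h => // t; apply: (mod_mono_inj Hj); rewrite jp.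
  have [z zE] := ex_z t.
  transitivity (hat (i v') t).
    rewrite hat_L; congr (e _); apply/ffunP => l.
    by rewrite [LHS]hE scale_lfunE id_lfunE ffunE.
  apply/ffunP => s; rewrite [LHS]hat_comp v'E (vE _ (Hu s) t z zE) zE.
  by rewrite [RHS]e_comp.
have [s Hs sE] := trace_splits hered rigidT Hj Hp lifts.
have hat_j v t : exists q, j q = hat (i v) t.
  by rewrite hat_L -jp; eexists.
have ex_c l v : exists c, forall t q,
    j q = hat (i v) t -> phi c t = component (s q) l.
  have [|g Hg gE] := lift_mono Hj (hat_hom (i v)).
    by move=> t; apply/memv_limgP; apply: hat_j.
  have [pr Hpr prE] := pow_proj T l.
  have [c cE] := proj1 (phi_img _) (is_hom_comp Hpr (is_hom_comp Hs Hg)).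
  exists c => t q qE; rewrite cE !comp_lfunE prE; congr (component (s _) l).
  by apply: (mod_mono_inj Hj); rewrite gE.
have /fin_all_exists[chi chiE] (l : 'I_d) : exists chi : 'Hom(K, reg C),
    forall v t q, j q = hat (i v) t -> phi (chi v) t = component (s q) l.
  have [|||chi chiE] := @linear_relation k K (reg C) fullv (fun v c =>
      forall t q, j q = hat (i v) t -> phi c t = component (s q) l).
  - by move=> v _; apply: ex_c.
  - move=> a v v' c c' vc v'c' t q qE.
    have [q1 q1E] := hat_j v t; have [q2 q2E] := hat_j v' t.
    have -> : q = a *: q1 + q2.
      apply: (mod_mono_inj Hj); rewrite !linearP /= qE q1E q2E.
      by rewrite !linearP /= add_lfunE scale_lfunE.
    rewrite linearP add_lfunE scale_lfunE (vc _ _ q1E) (v'c' _ _ q2E).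
    by rewrite linearP /component !ffunE.
  - move=> c cE; apply: phi_ext => t; rewrite (cE t 0).
      by rewrite !linear0 /component ffunE zero_lfunE.
    by rewrite !linear0 zero_lfunE.
  exists chi => v t q qE; have [c cE] := ex_c l v.
  by rewrite (chiE v c) ?memvf //; apply: cE.
have chi_hom l : is_hom (chi l).
  move=> v c; apply: phi_ext => t.
  have [q qE] := hat_j v (phi c t).
  rewrite phiME (chiE l v _ q qE); apply: chiE.
  by rewrite qE Hih hatM.
apply: (@dual_basis_projective _ _ K d b chi); split=> // v.
apply: (mod_mono_inj Hi); rewrite (ux (i v)) [RHS]ux; apply: eq_bigr => a _.
congr (ract P1 _ _); apply: phi_ext => t; have [q qE] := hat_j v t.
rewrite -hat_comp -qE -[q]sE jp e_comp !linear_sum sum_lfunE.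
apply: eq_bigr => l _; rewrite /= -(chiE l v t q qE) Hih Hu phiME //.
Qed.

End EndomorphismAlgebra.

Lemma tilted_kernel_projective (k : fieldType) (C : falgType k)
    (P1 P0 K : rmod C) (f : 'Hom(P1, P0)) (i : 'Hom(K, P1)) :
  tilted C -> projective P1 -> projective P0 -> is_hom f ->
  mod_mono i -> limg i = lker f -> projective K.
Proof.
move=> [A [T [hered [pdT extT _] [phi [phi_ker phi_img phi1 phiM]]]]].
apply: (kernel_projective hered _ phi_ker phi_img phiM).
exact: ext1_vanishes_of_ext_zero.
Qed.

(** * Extensions over the trivial extension *)

Section TrivialExtension.
Variables (k : fieldType) (C : falgType k) (E : bimod C).
Local Notation B := (trivext E).
Implicit Types M X : rmod C.

(** These are the homomorphisms from the tensor product of [M] and [E] over [C]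
    to [X]. *)
Definition balanced M X (b : 'Hom(M, 'Hom(E, X))) : Prop :=
  (forall m c e, b (ract M m c) e = b m (bil E c e)) /\
  (forall m e c, b m (bir E e c) = ract X (b m e) c).

Definition balanced_zero M X : Prop :=
  forall b : 'Hom(M, 'Hom(E, X)), balanced b -> b = 0.

Let linear_fun0 (V W : vectType k) (g : V -> W) : linear g -> g 0 = 0.
Proof.
by move=> /(_ (-1) 0 0); rewrite scaleN1r oppr0 addr0 scaleN1r addNr.
Qed.

Lemma bil0 c : bil E c 0 = 0.
Proof. exact: linear_fun0 (bil_linearr c). Qed.
Lemma bir0 c : bir E 0 c = 0.
Proof. exact: linear_fun0 (bir_linearl c). Qed.
Lemma bil0l e : bil E 0 e = 0.
Proof. exact: (@linear_fun0 C E) (bil_linearl e). Qed.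
Let trivextM (x y : B) :
  x * y = (x.1 * y.1, bil E x.1 y.2 + bir E x.2 y.1).
Proof. by []. Qed.

Let ract_regB (x y : B) :
  ract (reg B) x y = (x.1 * y.1, bil E x.1 y.2 + bir E x.2 y.1) :> B.
Proof. by []. Qed.

Lemma inflate_hom M X (f : 'Hom(M, X)) :
  is_hom f -> is_hom (f : 'Hom(inflate E M, inflate E X)).
Proof. by move=> Hf x b; apply: Hf. Qed.

Lemma inflate_mono M X (f : 'Hom(M, X)) :
  mod_mono f -> mod_mono (f : 'Hom(inflate E M, inflate E X)).
Proof. by case=> Hf fK; split=> //; apply: inflate_hom. Qed.

Lemma inflate_epi M X (f : 'Hom(M, X)) :
  mod_epi f -> mod_epi (f : 'Hom(inflate E M, inflate E X)).
Proof. by case=> Hf fK; split=> //; apply: inflate_hom. Qed.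

Section FreePresentation.
Variables (M X : rmod C) (n : nat) (m : 'I_n -> M).
Variables (pC : 'Hom(pow (reg C) n, M)) (pB : 'Hom(pow (reg B) n, inflate E M)).
Hypotheses (pC_epi : mod_epi pC) (pB_epi : mod_epi pB).
Hypothesis pCE : forall v, pC v = \sum_i ract M (m i) (component v i).
Hypothesis pBE : forall v, pB v = \sum_i ract M (m i) (component v i).1.
Variables (KC : rmod C) (iC : 'Hom(KC, pow (reg C) n)).
Variables (KB : rmod B) (iB : 'Hom(KB, pow (reg B) n)).
Hypotheses (iC_mono : mod_mono iC) (iC_img : limg iC = lker pC).
Hypotheses (iB_mono : mod_mono iB) (iB_img : limg iB = lker pB).
Variables (fstn : 'Hom(pow (reg B) n, pow (reg C) n)).
Variables (inln : 'Hom(pow (reg C) n, pow (reg B) n)).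
Hypothesis fstnE : forall v i, component (fstn v) i = (component v i).1.
Hypothesis inlnE : forall v i, component (inln v) i = (component v i, 0) :> B.

Let iC_hom : is_hom iC. Proof. by case: iC_mono. Qed.
Let iB_hom : is_hom iB. Proof. by case: iB_mono. Qed.
Let pC_hom : is_hom pC. Proof. by case: pC_epi. Qed.
Let pB_hom : is_hom pB. Proof. by case: pB_epi. Qed.

Let pB_fst v : pB v = pC (fstn v).
Proof. by rewrite pBE pCE; apply: eq_bigr => i _; rewrite fstnE. Qed.

Let fst_inl v : fstn (inln v) = v.
Proof. by apply/ffunP => i; rewrite [LHS]fstnE inlnE. Qed.

Let fstn_hom : is_hom (fstn : 'Hom(_, inflate E (pow (reg C) n))).
Proof.
by move=> v b; apply/ffunP => i; rewrite [LHS]fstnE !component_act fstnE.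
Qed.

Let inlM v c :
  inln (ract (pow (reg C) n) v c) = ract (pow (reg B) n) (inln v) (c, 0).
Proof.
apply/ffunP => i; rewrite [LHS]inlnE component_act [RHS]component_act inlnE.
by rewrite [RHS]trivextM /= bil0 bir0 addr0.
Qed.

Lemma ext1_of_ext1_inflate :
  ext1_vanishes (inflate E M) (inflate E X) -> ext1_vanishes M X.
Proof.
move=> ext.
apply: (ext1_vanishesI (@free_projective k C n) (And3 iC_mono iC_img pC_epi)).
move=> f Hf.
have [|h Hh hE] :=
  lift_mono (inflate_mono iC_mono) (is_hom_comp fstn_hom iB_hom).
  move=> z; rewrite [limg _]iC_img memv_ker comp_lfunE -pB_fst.
  by rewrite (exact0 _ iB_img).
have [G HG GE] := ext _ _ _ _ (@free_projective k B n)
  (And3 iB_mono iB_img pB_epi) _ (is_hom_comp (inflate_hom Hf) Hh).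
exists (G \o inln)%VF.
  by move=> v c; rewrite !comp_lfunE inlM HG.
move=> y; rewrite comp_lfunE.
have [|z zE] := @exactP _ _ _ _ _ _ _ (inln (iC y)) iB_img.
  by rewrite pB_fst fst_inl (exact0 _ iC_img).
rewrite -zE GE comp_lfunE; congr (f _); apply: (mod_mono_inj iC_mono).
by rewrite hE comp_lfunE zE fst_inl.
Qed.

(** The map on the kernel of [B^n -> M] defined by [b] on the components in [E]
    is linear over [B] because it is balanced; an extension to [B^n] has to
    vanish on multiples of [E]. *)
Lemma balanced_zero_of_ext1_inflate :
  (forall y, exists a : 'I_n -> C, y = \sum_i ract M (m i) (a i)) ->
  ext1_vanishes (inflate E M) (inflate E X) -> balanced_zero M X.
Proof.
move=> gen ext b [bl br].
have [|F FE] := @lfun_ex k (pow (reg B) n) X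
    (fun v => \sum_i b (m i) (component v i).2).
  move=> a v v'; rewrite scaler_sumr -big_split; apply: eq_bigr => i _.
  by rewrite /component !ffunE /= linearP.
have HF : is_hom ((F \o iB)%VF : 'Hom(KB, inflate E X)).
  move=> z c; rewrite !comp_lfunE iB_hom !FE ract_suml.
  have : b (pC (fstn (iB z))) c.2 = 0.
    by rewrite -pB_fst (exact0 _ iB_img) linear0 zero_lfunE.
  rewrite pCE linear_sum sum_lfunE => b0.
  rewrite -[RHS]add0r -[X in _ = X + _]b0 -big_split; apply: eq_bigr => i _.
  by rewrite component_act ract_regB /= linearD /= br fstnE bl.
have [G HG GE] := ext _ _ _ _ (@free_projective k B n)
  (And3 iB_mono iB_img pB_epi) _ HF.
have bm i e : b (m i) e = 0.
  pose v : pow (reg B) n := ([ffun j => ((i == j)%:R, 0)] : {ffun 'I_n -> B}).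
  have ve j : component (ract _ v (0, e)) j = (0, if j == i then e else 0) :> B.
    rewrite component_act /component ffunE [LHS]trivextM /= mulr0 bir0 addr0.
    by rewrite eq_sym; case: eqP => _; rewrite ?bil1 ?bil0l.
  have [|z zE] := @exactP _ _ _ _ _ _ _ (ract _ v (0, e)) iB_img.
    by rewrite pB_hom; apply: ract0r.
  have := GE z; rewrite zE HG /= ract0r comp_lfunE zE FE => /esym.
  rewrite (bigD1 i) //= big1 => [|j ji]; last first.
    by rewrite ve (negPf ji) linear0.
  by rewrite ve eqxx addr0.
apply/lfunP => y; apply/lfunP => e; have [a ->] := gen y.
rewrite linear_sum sum_lfunE big1 ?zero_lfunE // => i _.
by rewrite /= bl bm.
Qed.

(** A map [f] on the kernel of [B^n -> M] restricts to [E^n], where it is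
    determined by a balanced map; if that is zero, then [f] factors through the
    kernel of [C^n -> M]. *)
Lemma ext1_inflate_of :
  ext1_vanishes M X -> balanced_zero M X ->
  ext1_vanishes (inflate E M) (inflate E X).
Proof.
move=> ext bz.
apply: (ext1_vanishesI (@free_projective k B n) (And3 iB_mono iB_img pB_epi)).
move=> f Hf; pose L : 'Hom(pow (reg B) n, KB) := (iB^-1)%VF.
have iL v : pB v = 0 -> iB (L v) = v.
  by move=> v0; rewrite limg_lfunVK // iB_img memv_ker v0.
have Li z : L (iB z) = z.
  by apply: (mod_mono_inj iB_mono); rewrite iL // (exact0 _ iB_img).
have [s sP] : exists s : 'Hom(M, pow (reg C) n), forall y, pC (s y) = y.
  have [|s sP] := @linear_section k _ _ fullv pC.
    by move=> y; have [v vE] := epi_surj y pC_epi; exists v; rewrite ?memvf.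
  by exists s => y; case: (sP y).
pose act0 v e := ract (pow (reg B) n) (inln v) (0, e).
have pB_act0 v e : pB (act0 v e) = 0 by rewrite pB_hom; apply: ract0r.
have [||b bE] := @bilinear_ex k M E X (fun y e => f (L (act0 (s y) e))).
- move=> e a y y'; rewrite /act0 (linearP s) (linearP inln) ract_linearl.
  by rewrite (linearP L) (linearP f).
- move=> y a e e'; rewrite /act0.
  rewrite (_ : ((0, _) : B) = a *: (0, e) + (0, e')); last first.
    by congr (_, _); rewrite /= ?scaler0 ?addr0.
  by rewrite ract_linearr (linearP L) (linearP f).
(* The value does not depend on the presentation [v] of [pC v], as [E] acts by
   zero on [X]. *)
have bpC v e : b (pC v) e = f (L (act0 v e)).
  rewrite bE; apply/eqP; rewrite -subr_eq0 -(linearB f) -(linearB L) /act0.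
  rewrite -ractBl -(linearB inln).
  have [|z zE] := @exactP _ _ _ _ _ _ _ (inln (s (pC v) - v)) iB_img.
    by rewrite pB_fst fst_inl linearB /= sP subrr.
  by rewrite -[X in ract _ X _]zE -iB_hom /= Li Hf; apply/eqP; apply: ract0r.
have b0 : b = 0.
  apply: bz; split=> [y c e | y e c].
    rewrite -{1}(sP y) -pC_hom bpC bE; congr (f (L _)).
    rewrite /act0 inlM -ractM; congr (ract _ _ _).
    by rewrite trivextM /= mulr0 bir0 addr0.
  rewrite !bE (_ : act0 _ _ = ract (pow (reg B) n) (act0 (s y) e) (c, 0)).
    by rewrite -{1}(iL (act0 (s y) e)) // -iB_hom Li Hf.
  rewrite /act0 -ractM; congr (ract _ _ _).
  by rewrite trivextM /= mul0r bil0l add0r.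
have f0 z : fstn (iB z) = 0 -> f z = 0.
  move=> z0; rewrite -(Li z).
  pose v (i : 'I_n) : pow (reg C) n :=
    ([ffun j => (i == j)%:R] : {ffun 'I_n -> C}).
  rewrite (_ : iB z = \sum_i act0 (v i) (component (iB z) i).2).
    by rewrite !linear_sum big1 //= => i _; rewrite -bpC b0 !zero_lfunE.
  apply/ffunP => j; rewrite sum_ffunE.
  have act0E i e : act0 (v i) e j = (0, if i == j then e else 0) :> B.
    rewrite -/(component _ _) component_act inlnE /component ffunE.
    rewrite [LHS]trivextM /= mulr0 bir0 addr0.
    by case: eqP => _; rewrite ?bil1 ?bil0l.
  rewrite (bigD1 j) //= big1 => [|i ij]; last by rewrite act0E (negPf ij).
  rewrite addr0 act0E eqxx [LHS]surjective_pairing -fstnE z0 /component.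
  by rewrite ffunE.
pose f' : 'Hom(KC, X) := (f \o (L \o (inln \o iC)))%VF.
have f'E y : f' y = f (L (inln (iC y))) by rewrite !comp_lfunE.
have pBi y : pB (inln (iC y)) = 0 by rewrite pB_fst fst_inl (exact0 _ iC_img).
have Hf' : is_hom f'.
  move=> y c; rewrite !f'E iC_hom inlM -{1}(iL (inln (iC y))) //.
  by rewrite -iB_hom Li Hf.
have [g Hg gE] := ext _ _ _ _ (@free_projective k C n)
  (And3 iC_mono iC_img pC_epi) _ Hf'.
exists (g \o fstn)%VF.
  exact: (is_hom_comp (inflate_hom Hg) fstn_hom).
move=> z; rewrite comp_lfunE.
have [|y yE] := @exactP _ _ _ _ _ _ _ (fstn (iB z)) iC_img.
  by rewrite -pB_fst (exact0 _ iB_img).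
rewrite -yE gE f'E yE; apply/eqP; rewrite -subr_eq0 -linearB; apply/eqP/f0.
rewrite !linearB /= iL ?fst_inl ?subrr //.
by rewrite pB_fst fst_inl -pB_fst (exact0 _ iB_img).
Qed.

End FreePresentation.

(** If [K] is the kernel of [C^n -> M], then the kernel of [B^n -> M] modulo its
    multiple by [E] is the direct sum of [K] and [M (x) E]. *)
Lemma ext1_inflate M X :
  ext1_vanishes (inflate E M) (inflate E X) <->
  ext1_vanishes M X /\ balanced_zero M X.
Proof.
have [n [m gen]] := generators M.
have [pC HpC pCE] := free_cover m.
have [pB HpB pBE] := @free_cover k B (inflate E M) n m.
have pC_epi : mod_epi pC.
  apply: epiI => // y; have [a ->] := gen y.
  exists ([ffun i => a i] : {ffun 'I_n -> C}).
  by rewrite pCE; apply: eq_bigr => i _; rewrite /component ffunE.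
have pB_epi : mod_epi pB.
  apply: epiI => // y; have [a ->] := gen y.
  exists ([ffun i => (a i, 0)] : {ffun 'I_n -> B}).
  by rewrite pBE; apply: eq_bigr => i _; rewrite /component ffunE.
have [KC [iC [iC_mono iC_img]]] := kernel_ex HpC.
have [KB [iB [iB_mono iB_img]]] := kernel_ex HpB.
have [|fstn fstnE] := @lfun_ex k (pow (reg B) n) (pow (reg C) n)
    (fun v => [ffun i => (component v i).1] : {ffun 'I_n -> C}).
  by move=> a v v'; apply/ffunP => i; rewrite /component !ffunE.
have fstnE' v i : component (fstn v) i = (component v i).1.
  by rewrite fstnE {1}/component ffunE.
have [|inln inlnE] := @lfun_ex k (pow (reg C) n) (pow (reg B) n)
    (fun v => [ffun i => (component v i, 0)] : {ffun 'I_n -> B}).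
  move=> a v v'; apply/ffunP => i; rewrite /component !ffunE.
  by congr (_, _); rewrite /= ?scaler0 ?addr0.
have inlnE' v i : component (inln v) i = (component v i, 0) :> B.
  by rewrite inlnE {1}/component ffunE.
split=> [ext | [ext bz]]; last first.
  exact: (ext1_inflate_of pC_epi pB_epi pCE pBE iC_mono iC_img iB_mono iB_img
    fstnE' inlnE').
split.
  exact: (ext1_of_ext1_inflate pC_epi pB_epi pCE pBE iC_mono iC_img iB_mono
    iB_img fstnE' inlnE').
exact: (balanced_zero_of_ext1_inflate pB_epi pCE pBE iB_mono iB_img fstnE' gen).
Qed.

End TrivialExtension.

Section GenOverTrivialExtension.
Variables (k : fieldType) (C : falgType k) (E : bimod C).
Local Notation B := (trivext E).

Section Restriction.
Variable X : rmod B.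

Definition restrict_act (x : X) (c : C) : X := ract X x ((c, 0) : B).
Fact restrict_linearl c : linear (restrict_act^~ c).
Proof. exact: ract_linearl. Qed.
Fact restrict_linearr x : linear (restrict_act x).
Proof.
move=> a c d; rewrite /restrict_act -ract_linearr; congr (ract _ _ _).
by congr (_, _); rewrite /= scaler0 addr0.
Qed.
Fact restrict_act1 x : restrict_act x 1 = x.
Proof. exact: ract1. Qed.
Fact restrict_actM x c d :
  restrict_act x (c * d) = restrict_act (restrict_act x c) d.
Proof.
rewrite /restrict_act -ractM; congr (ract _ _ _); congr (_, _) => /=.
by rewrite bil0 bir0 addr0.
Qed.
Definition restrict : rmod C :=
  @RMod k C X restrict_act restrict_linearl restrict_linearr restrict_act1
    restrict_actM.

End Restriction.

Lemma Gen_inflate (M X : rmod C) :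
  in_Gen M X -> in_Gen (inflate E M) (inflate E X).
Proof.
move=> [d [Md [p [[inj [pr [Hinj Hpr pi0 pi1 pi2]]] Hp]]]].
exists d, (inflate E Md), p; split; last exact: inflate_epi.
by exists inj, pr; split=> // i; apply: inflate_hom.
Qed.

(** [E] annihilates the inflated module [M], hence every module that it
    generates. *)
Lemma Gen_inflate_restrict (M : rmod C) (X : rmod B) :
  in_Gen (inflate E M) X ->
  in_Gen M (restrict X) /\ mod_iso X (inflate E (restrict X)).
Proof.
move=> [d [Md [p [[inj [pr [Hinj Hpr pi0 pi1 pi2]]] Hp]]]].
have Hph : is_hom p by case: Hp.
have E0 (x : X) e : ract X x ((0, e) : B) = 0.
  have [y <-] := epi_surj x Hp; rewrite -Hph -[y]id_lfunE -pi2 sum_lfunE.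
  rewrite ract_suml big1 ?linear0 // => i _.
  rewrite comp_lfunE -Hinj (_ : ract _ _ _ = 0) ?linear0 //.
  exact: ract0r.
split.
  exists d, (restrict Md), p; split.
    exists inj, pr; split=> // i x c; first exact: (Hinj i x ((c, 0) : B)).
    exact: (Hpr i x ((c, 0) : B)).
  by case: Hp => _ Hp; split=> // x c; apply: (Hph x ((c, 0) : B)).
exists \1%VF; have H1 : is_hom (\1%VF : 'Hom(X, inflate E (restrict X))).
  move=> x b; rewrite !id_lfunE.
  transitivity (ract X x ((b.1, 0) : B) + ract X x ((0, b.2) : B)); last first.
    by rewrite E0 addr0.
  rewrite -(@ractDr k B X x (b.1, 0) (0, b.2)); congr (ract X x _).
  by case: b => c e; congr (_, _); rewrite /= ?addr0 ?add0r.
split; first by apply: monoI => // x; rewrite id_lfunE.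
by apply: epiI => // y; exists y; rewrite id_lfunE.
Qed.

Lemma ext1_vanishes_iso (A : falgType k) (M X Y : rmod A) :
  mod_iso X Y -> ext1_vanishes M Y -> ext1_vanishes M X.
Proof.
move=> [u [umono uepi]] ext P K p i HP se f Hf.
have Hu : is_hom u by case: umono.
have [g Hg gE] := ext _ _ _ _ HP se _ (is_hom_comp Hu Hf).
have [|h Hh hE] := lift_mono umono Hg.
  by move=> z; case: uepi => _ ->; apply: memvf.
exists h => // x; apply: (mod_mono_inj umono).
by rewrite hE gE comp_lfunE.
Qed.

Lemma tau_rigid_inflate (M : rmod C) :
  tau_rigid M ->
  (tau_rigid (inflate E M) <-> forall X, in_Gen M X -> balanced_zero E M X).
Proof.
move=> /tau_rigid_ext1 rigM.
apply: (iff_trans (tau_rigid_ext1 (inflate E M))); split=> [ext X MX | bz X MX].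
  by have /ext1_inflate[] := ext _ (Gen_inflate MX).
have [MX' iso] := Gen_inflate_restrict MX.
apply: (ext1_vanishes_iso iso); apply/ext1_inflate; split; last exact: bz.
exact: rigM.
Qed.

End GenOverTrivialExtension.

(** * Injective resolutions of length two *)

Section DimensionShift.
Variables (k : fieldType) (A : falgType k).
Implicit Types M N X Y L I P K : rmod A.

Lemma ext1_projective X Y : projective X -> ext1_vanishes X Y.
Proof.
move=> HX P K p i HP [Hi ip Hp] f Hf.
have Hph : is_hom p by case: Hp.
have [s Hs sE] := projective_lift HX Hp (@is_hom_id k A X).
have [|r Hr rE] :=
  lift_mono Hi (is_homB (@is_hom_id k A P) (is_hom_comp Hs Hph)).
  move=> x; rewrite ip memv_ker add_lfunE opp_lfunE id_lfunE comp_lfunE.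
  by rewrite linearB /= sE id_lfunE subrr.
exists (f \o r)%VF; first exact: is_hom_comp.
move=> x; rewrite comp_lfunE; congr (f _); apply: (mod_mono_inj Hi).
rewrite rE add_lfunE opp_lfunE id_lfunE comp_lfunE.
by rewrite (exact0 _ ip) linear0 subr0.
Qed.

(** Dimension shifting on both sides: [Ext^1(X, N)] is [Ext^2(X, L)], which is
    [Ext^1(K, L)]. *)
Lemma ext1_shift X P K L I N (i : 'Hom(K, P)) (p : 'Hom(P, X))
    (j : 'Hom(L, I)) (q : 'Hom(I, N)) :
  projective P -> short_exact i p -> injective_mod I -> short_exact j q ->
  ext1_vanishes K L -> ext1_vanishes X N.
Proof.
move=> HP se HI [Hj jq Hq] ext; apply: (ext1_vanishesI HP se) => f Hf.
have [Hi ip Hp] := se.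
have [Hjh Hqh] : is_hom j /\ is_hom q by case: Hj Hq => ? _ [].
have [Q [c [HQ Hc]]] := projective_epi_ex K.
have Hch : is_hom c by case: Hc.
have [R [n [Hn nc]]] := kernel_ex Hch; have Hnh : is_hom n by case: Hn.
have [F HF FE] := projective_lift HQ Hq (is_hom_comp Hf Hch).
have [|w Hw wE] := lift_mono Hj (is_hom_comp HF Hnh).
  move=> z; rewrite jq memv_ker comp_lfunE FE comp_lfunE (exact0 _ nc).
  by rewrite linear0.
have [w' Hw' w'E] := ext _ _ _ _ HQ (And3 Hn nc Hc) _ Hw.
have [|G HG GE] := factor_epi Hc (is_homB HF (is_hom_comp Hjh Hw')).
  move=> x /(exactP nc)[z <-].
  by rewrite add_lfunE opp_lfunE comp_lfunE w'E wE comp_lfunE subrr.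
have [H HH HE] := injective_extend HI Hi HG.
exists (q \o H)%VF; first exact: is_hom_comp.
move=> x; rewrite comp_lfunE HE; have [z <-] := epi_surj x Hc.
rewrite GE add_lfunE opp_lfunE comp_lfunE linearB /= FE (exact0 _ jq).
by rewrite comp_lfunE subr0.
Qed.

(** The extension problem is pulled back to a projective covering [Y]. *)
Lemma injective_of_ext1 L : (forall X, ext1_vanishes X L) -> injective_mod L.
Proof.
move=> ext X Y i f Hi Hf; have Hih : is_hom i by case: Hi.
have [P [c [HP Hc]]] := projective_epi_ex Y.
have Hch : is_hom c by case: Hc.
have [|S [s [Hs sE]]] := @submodule_ex k A P (c @^-1: limg i)%VS.
  move=> x a; rewrite -!memv_preim Hch; exact: is_submod_img.
have Hsh : is_hom s by case: Hs.
have sP x : c x \in limg i <-> exists y, s y = x.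
  by rewrite memv_preim -sE; apply: memv_limgP.
have [|c' Hc' c'E] := lift_mono Hi (is_hom_comp Hch Hsh).
  by move=> z; rewrite comp_lfunE; apply/sP; exists z.
have [Q [q [Hq qs]]] := quotient_ex (is_submod_img Hsh).
have [g Hg gE] :=
  ext Q _ _ _ _ HP (And3 Hs (esym qs) Hq) _ (is_hom_comp Hf Hc').
have [|h Hh hE] := factor_epi Hc Hg.
  move=> x cx; have /sP[z zE] : c x \in limg i by rewrite cx mem0v.
  rewrite -zE gE comp_lfunE (_ : c' z = 0) ?linear0 //.
  by apply: (mono_ker Hi); rewrite c'E comp_lfunE zE.
exists h => //; apply/lfunP => x; rewrite comp_lfunE.
have [y yE] := epi_surj (i x) Hc.
have /sP[z zE] : c y \in limg i by rewrite yE; apply/memv_limgP; exists x.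
rewrite -yE hE -zE gE comp_lfunE; congr (f _); apply: (mod_mono_inj Hi).
by rewrite c'E comp_lfunE zE yE.
Qed.

(** [Ext^1(X, L)] is [Ext^3(X, M)], which is [Ext^1] of the second syzygy of
    [X]. *)
Lemma second_cosyzygy_injective M N L (I0 I1 : rmod A)
    (j : 'Hom(M, I0)) (q : 'Hom(I0, N)) (j' : 'Hom(N, I1)) (q' : 'Hom(I1, L)) :
  (forall (P1 P0 K : rmod A) (f : 'Hom(P1, P0)) (i : 'Hom(K, P1)),
     projective P1 -> projective P0 -> is_hom f -> mod_mono i ->
     limg i = lker f -> projective K) ->
  injective_mod I0 -> short_exact j q ->
  injective_mod I1 -> short_exact j' q' ->
  injective_mod L.
Proof.
move=> gldim HI0 se0 HI1 se1; apply: injective_of_ext1 => X.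
have [P0 [p0 [HP0 Hp0]]] := projective_epi_ex X.
have Hp0h : is_hom p0 by case: Hp0.
have [K0 [i0 [Hi0 ip0]]] := kernel_ex Hp0h; have Hi0h : is_hom i0 by case: Hi0.
have [P1 [p1 [HP1 Hp1]]] := projective_epi_ex K0.
have Hp1h : is_hom p1 by case: Hp1.
have [K1 [i1 [Hi1 ip1]]] := kernel_ex Hp1h.
apply: (ext1_shift HP0 (And3 Hi0 ip0 Hp0) HI1 se1).
apply: (ext1_shift HP1 (And3 Hi1 ip1 Hp1) HI0 se0).
apply: ext1_projective.
apply: (gldim _ _ _ _ _ HP1 HP0 (is_hom_comp Hi0h Hp1h) Hi1).
rewrite ip1; apply/vspaceP => x; rewrite !memv_ker comp_lfunE.
by apply/eqP/eqP => [-> | /(mono_ker Hi0)]; rewrite ?linear0.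
Qed.

End DimensionShift.

Section CodualResolution.
Variables (k : fieldType) (A : falgType k).
Variables (N : rmod A) (P1 P0 : rmod A^c).
Variables (p1 : 'Hom(P1, P0)) (p0 : 'Hom(P0, dual N)).
Hypotheses (p1_hom : is_hom p1) (p0_epi : mod_epi p0) (p10 : limg p1 = lker p0).

(** The projective presentation of [DN] dualizes to an injective copresentation
    of [N]; exactness at [D P0] uses that [N] is its own bidual. *)
Lemma codual_resolution : exists (j : 'Hom(N, codual P0))
    (q : 'Hom(codual P0, codual P1)),
  [/\ mod_mono j, limg j = lker q, is_hom q &
    forall (phi : 'Hom(P0, k^o)) x, (q phi : 'Hom(P1, k^o)) x = phi (p1 x)].
Proof.
have p0_hom : is_hom p0 by case: p0_epi.
have [j Hj jE] := to_codual p0_hom.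
have [|q qE] := @lfun_ex k (codual P0) (codual P1)
    (fun phi : 'Hom(P0, k^o) => (phi \o p1)%VF).
  by move=> a u v; rewrite comp_lfunDl comp_lfunZl.
have qEE (phi : 'Hom(P0, k^o)) x : (q phi : 'Hom(P1, k^o)) x = phi (p1 x).
  by rewrite qE comp_lfunE.
have Hq : is_hom q.
  move=> phi a; apply/lfunP => x.
  by rewrite qEE !codual_actE qEE p1_hom.
exists j, q; split=> //; first exact: codual_mono jE.
apply/vspaceP => phi; rewrite memv_ker; apply/idP/eqP => [/memv_limgP[x <-]|q0].
  by apply/lfunP => y; rewrite qEE jE (exact0 _ p10) !zero_lfunE.
pose phi' : 'Hom(P0, k^o) := phi.
have [Phi PhiE] : exists Phi : 'Hom('Hom(N, k^o), k^o),
    forall y, Phi (p0 y) = phi' y.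
  exists (phi' \o p0^-1)%VF => y; rewrite comp_lfunE.
  apply/eqP; rewrite -subr_eq0 -linearB /=; apply/eqP.
  have [|x <-] := @exactP _ _ _ _ _ _ _ ((p0^-1)%VF (p0 y) - y) p10.
    by rewrite linearB /= limg_lfunVK ?subrr // memv_img ?memvf.
  by rewrite -qEE q0 zero_lfunE.
have [x xE] := form_is_eval Phi.
apply/memv_limgP; exists x; apply/lfunP => y.
by rewrite jE -/phi' -PhiE xE.
Qed.

(** If the image [L] of [D P0 -> D P1] is injective, its inclusion in [D P1]
    splits; the resulting idempotent of [D P1] transposes to an idempotent of
    [P1] with kernel [Ker p1], so that the superfluous module [Ker p1] is a
    direct summand. *)
Lemma presentation_mono (L : rmod A)
    (q : 'Hom(codual P0, codual P1)) (l : 'Hom(L, codual P1)) :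
  (forall (phi : 'Hom(P0, k^o)) x, (q phi : 'Hom(P1, k^o)) x = phi (p1 x)) ->
  injective_mod L -> mod_mono l -> limg l = limg q -> superfluous (lker p1) ->
  mod_mono p1.
Proof.
move=> qE HL Hl lq sup; have Hlh : is_hom l by case: Hl.
have [r Hr rE] := injective_extend HL Hl (@is_hom_id k A L).
pose e : 'Hom('Hom(P1, k^o), 'Hom(P1, k^o)) := (l \o r)%VF.
have e_hom (phi : 'Hom(P1, k^o)) a x : (e phi) (ract P1 x a) =
    e (ract (codual P1) phi a) x.
  transitivity ((ract (codual P1) ((l \o r)%VF phi) a : 'Hom(P1, k^o)) x).
    by rewrite codual_actE.
  by rewrite -(is_hom_comp Hlh Hr).
have [d dE] := transposed e.
have d_hom : is_hom (d : 'Hom(P1, P1)).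
  move=> x a; apply/eqP; rewrite -subr_eq0; apply/eqP/form_sep => phi.
  rewrite linearB /= dE e_hom -[phi (ract _ _ _)]codual_actE -dE.
  by rewrite subrr.
have p1d x : p1 (d x) = p1 x.
  apply/eqP; rewrite -subr_eq0; apply/eqP/form_sep => phi.
  rewrite linearB /= -!qE dE /e comp_lfunE.
  have [u <-] : exists u, l u = q phi.
    by apply/memv_limgP; rewrite lq; apply/memv_limgP; exists phi.
  by rewrite rE id_lfunE subrr.
have dK x : p1 x = 0 -> d x = 0.
  move=> p1x; apply: form_sep => phi; rewrite dE /e comp_lfunE.
  have /memv_limgP[psi <-] : l (r phi) \in limg q.
    by rewrite -lq; apply/memv_limgP; exists (r phi).
  by rewrite qE p1x linear0.
have dsurj : limg d = fullv.
  apply: sup; first exact: is_submod_img.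
  apply/vspaceP => x; rewrite memvf -[x](subrK (d x)) memv_add //.
    by rewrite memv_ker linearB /= p1d subrr.
  by apply/memv_limgP; exists x.
apply: monoI => // x /dK dx.
have : \dim (lker d) = 0%N.
  by apply/eqP; rewrite -(eqn_add2r (\dim (limg d))) -{1}[lker d]capfv
    limg_ker_dim dsurj.
move/eqP; rewrite dimv_eq0 => /eqP K0; apply/eqP.
by rewrite -memv0 -K0 memv_ker dx.
Qed.

End CodualResolution.

(** * The tensor product with [Ext^2(DC, C)] *)

Section Lifting.
Variables (k : fieldType) (A : falgType k).
Implicit Types X Y P I : rmod A.

Lemma lift_along P X Y (d : 'Hom(X, Y)) (f : 'Hom(P, Y)) :
  projective P -> is_hom d -> is_hom f -> (forall x, f x \in limg d) ->
  exists2 g : 'Hom(P, X), is_hom g & forall x, d (g x) = f x.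
Proof.
move=> HP Hd Hf fd; have [L [i [p [Hi Hp id ip]]]] := image_factor Hd.
have [|f' Hf' f'E] := lift_mono Hi Hf; first by move=> z; rewrite id.
have [g Hg gE] := projective_lift HP Hp Hf'.
by exists g => // x; rewrite -ip gE f'E.
Qed.

Lemma extend_along I X Y (d : 'Hom(X, Y)) (f : 'Hom(X, I)) :
  injective_mod I -> is_hom d -> is_hom f -> (forall x, d x = 0 -> f x = 0) ->
  exists2 g : 'Hom(Y, I), is_hom g & forall x, g (d x) = f x.
Proof.
move=> HI Hd Hf fd; have [L [i [p [Hi Hp id ip]]]] := image_factor Hd.
have [|f' Hf' f'E] := factor_epi Hp Hf.
  by move=> x px; apply: fd; rewrite -ip px linear0.
have [g Hg gE] := injective_extend HI Hi Hf'.
by exists g => // x; rewrite -ip gE f'E.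
Qed.

Definition res_projective X (R : proj_resolution X) n : projective (R n) :=
  @res_proj _ _ _ R n.
Definition res_hom X (R : proj_resolution X) n : is_hom (res_d R n) :=
  @res_d_hom _ _ _ R n.
Definition res_epi X (R : proj_resolution X) : mod_epi (res_aug R) :=
  @res_aug_epi _ _ _ R.
Arguments res_projective {X} R n.
Arguments res_hom {X} R n.
Arguments res_epi {X} R.

Lemma chain_lift_ex X (R : proj_resolution X) (h : 'End(X)) : is_hom h ->
  exists phi : forall n, 'End(R n), is_chain_lift h phi.
Proof.
move=> Hh.
pose S n := {p : 'End(R n) * 'End(R n.+1) |
  [/\ is_hom p.1, is_hom p.2 &
      forall x, res_d R n (p.2 x) = p.1 (res_d R n x)]}.
have [f0 Hf0 f0E] := projective_lift (res_projective R 0) (res_epi R)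
  (is_hom_comp Hh (proj1 (res_epi R))).
have [|f1 Hf1 f1E] := lift_along (res_projective R 1) (res_hom R 0)
    (is_hom_comp Hf0 (res_hom R 0)).
  move=> x; rewrite res_exact0 memv_ker comp_lfunE f0E comp_lfunE.
  by rewrite (exact0 _ (res_exact0 R)) linear0.
have [s0 s0E] : exists s0 : S 0%N, (sval s0).1 = f0.
  have f01 : [/\ is_hom f0, is_hom f1 &
      forall x, res_d R 0 (f1 x) = f0 (res_d R 0 x)].
    by split=> // x; rewrite f1E comp_lfunE.
  by exists (exist _ (f0, f1) f01).
have next n (p : S n) : exists q : S n.+1, (sval q).1 = (sval p).2.
  case: p => [[a b] [/= Ha Hb ab]].
  have [|c Hc cE] := lift_along (res_projective R n.+2) (res_hom R n.+1)
      (is_hom_comp Hb (res_hom R n.+1)).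
    move=> x; rewrite res_exactS memv_ker comp_lfunE ab.
    by rewrite (exact0 _ (res_exactS R n)) linear0.
  have bc : [/\ is_hom b, is_hom c &
      forall x, res_d R n.+1 (c x) = b (res_d R n.+1 x)].
    by split=> // x; rewrite cE comp_lfunE.
  by exists (exist _ (b, c) bc).
pose nxt n p := proj1_sig (constructive_indefinite_description _ (next n p)).
have nxtE n p : (sval (nxt n p)).1 = (sval p).2.
  by rewrite /nxt; case: constructive_indefinite_description.
pose s := fix s n : S n := match n with 0 => s0 | m.+1 => nxt m (s m) end.
exists (fun n => (sval (s n)).1); split=> [n | | n].
- by case: (sval (s n)) (svalP (s n)) => a b [].
- by apply/lfunP => x; rewrite [s 0%N]/= s0E comp_lfunE f0E.
- apply/lfunP => x; rewrite comp_lfunE [s n.+1]/= nxtE.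
  by case: (sval (s n)) (svalP (s n)) => a b [_ _ /= ->]; rewrite comp_lfunE.
Qed.

(** The image of [R 2] in [R 1] is the kernel of a map between projectives,
    hence projective. A dual basis of it expresses every 2-cocycle by 2-cocycles
    with values in [A]. *)
Lemma cocycle_basis X (R : proj_resolution X) :
  (forall (P1 P0 K : rmod A) (f : 'Hom(P1, P0)) (i : 'Hom(K, P1)),
     projective P1 -> projective P0 -> is_hom f -> mod_mono i ->
     limg i = lker f -> projective K) ->
  exists n (r : 'I_n -> R 2) (F : 'I_n -> 'Hom(R 2, reg A)),
    (forall i, ext_cocycle (F i)) /\
    forall Y (u : 'Hom(R 2, Y)), ext_cocycle u ->
      u = \sum_i (orbit_map (u (r i)) \o F i)%VF.
Proof.
move=> gldim; have [K [i [p [Hi Hp ker_i ip]]]] := image_factor (res_hom R 1).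
have HK : projective K.
  apply: (gldim _ _ _ _ _ (res_projective R 1) (res_projective R 0)
    (res_hom R 0) Hi).
  by rewrite ker_i res_exactS.
have Hph : is_hom p by case: Hp.
have [n [z [phi [Hphi zphi]]]] := projective_dual_basis HK.
have /fin_all_exists[r rE] (l : 'I_n) : exists r, p r = z l by apply: epi_surj.
have pK x : p x = 0 -> exists y, res_d R 2 y = x.
  by move=> px; apply: (exactP (res_exactS R 1)); rewrite -ip px linear0.
exists n, r, (fun l => phi l \o p)%VF; split=> [l | Y u [Hu ud]].
  split; first exact: is_hom_comp.
  apply/lfunP => x; rewrite !comp_lfunE zero_lfunE.
  suff -> : p (res_d R 2 x) = 0 by rewrite linear0.
  by apply: (mono_ker Hi); rewrite ip (exact0 _ (res_exactS R 1)).
apply/lfunP => x; apply/eqP; rewrite -subr_eq0; apply/eqP.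
have [|y yE] := pK (x - \sum_l ract _ (r l) (phi l (p x))).
  rewrite linearB /= linear_sum {1}(zphi (p x)).
  by apply/eqP; rewrite subr_eq0; apply/eqP/eq_bigr => l _; rewrite /= Hph rE.
transitivity (u (res_d R 2 y)).
  rewrite yE linearB /= linear_sum sum_lfunE; congr (_ - _).
  by apply: eq_bigr => l _; rewrite /= Hu !comp_lfunE orbit_mapE.
by rewrite -comp_lfunE ud zero_lfunE.
Qed.

End Lifting.
Arguments res_projective {k A X} R n.
Arguments res_hom {k A X} R n.
Arguments res_epi {k A X} R.

Lemma dual_reg_lmul_hom (k : fieldType) (A : falgType k) (c : A) :
  is_hom (dual_reg_lmul c).
Proof.
move=> phi a; rewrite !lfunE /= /dual_reg_lmul_fun /=; apply/lfunP => x.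
by rewrite !comp_lfunE !lfunE /= mulrA.
Qed.

Section ConnectingMap.
Variables (k : fieldType) (C : falgType k) (E : bimod C).
Variable R : proj_resolution (dual_reg C).
Variable cls : 'Hom('Hom(R 2, reg C), E).
Hypothesis cls_class : is_ext_class cls.
Hypothesis cls_left : forall (c : C) (f : 'Hom(R 2, reg C)), ext_cocycle f ->
  cls (amull c \o f)%VF = bil E c (cls f).
Hypothesis cls_right : forall (c : C) (phi : forall n, 'End(R n)),
  is_chain_lift (dual_reg_lmul c) phi ->
  forall f : 'Hom(R 2, reg C), ext_cocycle f ->
    cls (f \o phi 2)%VF = bir E (cls f) c.
Variables (n : nat) (r : 'I_n -> R 2) (F : 'I_n -> 'Hom(R 2, reg C)).
Hypothesis F_cocycle : forall i, ext_cocycle (F i).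
Hypothesis expand : forall (Y : rmod C) (u : 'Hom(R 2, Y)), ext_cocycle u ->
  u = \sum_i (orbit_map (u (r i)) \o F i)%VF.
Variables (M I0 N I1 I2 X : rmod C).
Variables (j : 'Hom(M, I0)) (q0 : 'Hom(I0, N)).
Variables (i : 'Hom(N, I1)) (q1 : 'Hom(I1, I2)).
Hypotheses (se0 : short_exact j q0) (se1 : short_exact i q1).
Hypotheses (HI0 : injective_mod I0) (HI1 : injective_mod I1).

Let j_mono : mod_mono j. Proof. by case: se0. Qed.
Let i_mono : mod_mono i. Proof. by case: se1. Qed.
Let q0_epi : mod_epi q0. Proof. by case: se0. Qed.
Let q1_epi : mod_epi q1. Proof. by case: se1. Qed.
Let jq : limg j = lker q0. Proof. by case: se0. Qed.
Let iq : limg i = lker q1. Proof. by case: se1. Qed.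
Let j_hom : is_hom j. Proof. by case: j_mono. Qed.
Let i_hom : is_hom i. Proof. by case: i_mono. Qed.
Let q0_hom : is_hom q0. Proof. by case: q0_epi. Qed.
Let q1_hom : is_hom q1. Proof. by case: q1_epi. Qed.

Let d0 := res_d R 0.
Let d1 := res_d R 1.
Let d2 := res_d R 2.
Let aug := res_aug R.
Let d0_hom : is_hom d0. Proof. exact: res_d_hom. Qed.
Let d1_hom : is_hom d1. Proof. exact: res_d_hom. Qed.
Let aug_epi : mod_epi aug. Proof. exact: res_aug_epi. Qed.
Let aug_hom : is_hom aug. Proof. by case: aug_epi. Qed.
Let ex0 : limg d0 = lker aug. Proof. exact: res_exact0. Qed.
Let ex1 : limg d1 = lker d0. Proof. exact: res_exactS. Qed.
Let ex2 : limg d2 = lker d1. Proof. exact: res_exactS. Qed.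

(** [Ext^2(DC, M)] is computed from the projective resolution of [DC] on one
    side and from the injective coresolution [M -> I0 -> I1 -> I2] on the other:
    the ladder of [h0] and [h1] shows that [h] and the cocycle [u] define the
    same class. The lemmas that follow say that this induces an isomorphism from
    the cokernel of [Hom(DC, I1) -> Hom(DC, I2)] to the cocycles modulo the
    coboundaries, compatible with the actions of [C]. *)
Definition connected (h : 'Hom(dual_reg C, I2)) (u : 'Hom(R 2, M)) : Prop :=
  is_hom u /\ exists (h0 : 'Hom(R 0, I1)) (h1 : 'Hom(R 1, I0)),
    [/\ is_hom h0, is_hom h1, forall x, q1 (h0 x) = h (aug x),
        forall x, i (q0 (h1 x)) = h0 (d0 x) & forall x, j (u x) = h1 (d1 x)].

Let connected_lin a h h' u u' :
  connected h u -> connected h' u' -> connected (a *: h + h') (a *: u + u').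
Proof.
move=> [Hu [h0 [h1 [H0 H1 e0 e1 e2]]]] [Hu' [h0' [h1' [H0' H1' e0' e1' e2']]]].
split; first exact: is_hom_lin.
exists (a *: h0 + h0'), (a *: h1 + h1'); split=> [||x|x|x].
- exact: is_hom_lin.
- exact: is_hom_lin.
- by rewrite !add_lfunE !scale_lfunE !linearP /= e0 e0'.
- by rewrite !add_lfunE !scale_lfunE !linearP /= e1 e1'.
- by rewrite !add_lfunE !scale_lfunE !linearP /= e2 e2'.
Qed.

Let connected_cocycle h u : connected h u -> ext_cocycle u.
Proof.
move=> [Hu [h0 [h1 [_ _ _ _ e2]]]]; split=> //; apply/lfunP => x.
rewrite comp_lfunE zero_lfunE; apply: (mono_ker j_mono).
by rewrite e2 (exact0 _ ex2) linear0.
Qed.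

Let connected_right h : is_hom h -> exists u, connected h u.
Proof.
move=> Hh.
have [h0 H0 e0] :=
  projective_lift (res_projective R 0) q1_epi (is_hom_comp Hh aug_hom).
have [|h1 H1 e1] := lift_along (res_projective R 1) (is_hom_comp i_hom q0_hom)
    (is_hom_comp H0 d0_hom).
  move=> x; have [y yE] : exists y, i y = h0 (d0 x).
    by apply: (exactP iq); rewrite e0 comp_lfunE (exact0 _ ex0) linear0.
  have [z zE] := epi_surj y q0_epi.
  by apply/memv_limgP; exists z; rewrite !comp_lfunE zE yE.
have [|u Hu e2] := lift_mono j_mono (is_hom_comp H1 d1_hom).
  move=> x; rewrite jq memv_ker comp_lfunE; apply/eqP/(mono_ker i_mono).
  by rewrite -[LHS]comp_lfunE e1 comp_lfunE (exact0 _ ex1) linear0.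
exists u; split=> //; exists h0, h1; split=> // x.
- by rewrite e0 comp_lfunE.
- by rewrite -[LHS]comp_lfunE e1 comp_lfunE.
- by rewrite e2 comp_lfunE.
Qed.

Let connected_left u : ext_cocycle u -> exists h, connected h u /\ is_hom h.
Proof.
move=> [Hu ud].
have [|h1 H1 e2] := extend_along HI0 d1_hom (is_hom_comp j_hom Hu).
  move=> x /(exactP ex2)[y <-]; rewrite comp_lfunE -[u _]comp_lfunE.
  by rewrite /d2 ud zero_lfunE linear0.
have [|h0 H0 e1] :=
  extend_along HI1 d0_hom (is_hom_comp i_hom (is_hom_comp q0_hom H1)).
  move=> x /(exactP ex1)[y <-]; rewrite !comp_lfunE e2 comp_lfunE (exact0 _ jq).
  by rewrite linear0.
have [|h Hh e0] := factor_epi aug_epi (is_hom_comp q1_hom H0).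
  move=> x /(exactP ex0)[y <-].
  by rewrite comp_lfunE e1 comp_lfunE (exact0 _ iq).
exists h; split=> //; split=> //; exists h0, h1; split=> // x.
- by rewrite e0 comp_lfunE.
- by rewrite e1 !comp_lfunE.
- by rewrite e2 comp_lfunE.
Qed.

Let connected_coboundary (g : 'Hom(dual_reg C, I1)) u :
  is_hom g -> connected (q1 \o g)%VF u ->
  exists2 w : 'Hom(R 1, M), is_hom w & u = (w \o d1)%VF.
Proof.
move=> Hg [Hu [h0 [h1 [H0 H1 e0 e1 e2]]]].
have [|a Ha aE] := lift_mono i_mono (is_homB H0 (is_hom_comp Hg aug_hom)).
  move=> x; rewrite iq memv_ker add_lfunE opp_lfunE linearB /= e0 !comp_lfunE.
  by rewrite subrr.
have [s Hs sE] := projective_lift (res_projective R 0) q0_epi Ha.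
have [|w Hw wE] := lift_mono j_mono (is_homB H1 (is_hom_comp Hs d0_hom)).
  move=> x; rewrite jq memv_ker; apply/eqP/(mono_ker i_mono).
  rewrite add_lfunE opp_lfunE !linearB /= e1 comp_lfunE sE aE.
  by rewrite add_lfunE opp_lfunE comp_lfunE (exact0 _ ex0) linear0 subr0 subrr.
exists w => //; apply/lfunP => x; apply: (mod_mono_inj j_mono).
rewrite comp_lfunE wE add_lfunE opp_lfunE comp_lfunE (exact0 _ ex1).
by rewrite linear0 subr0 e2.
Qed.

Let connected_trivial h (w : 'Hom(R 1, M)) :
  is_hom w -> connected h (w \o d1)%VF ->
  exists2 g : 'Hom(dual_reg C, I1), is_hom g & h = (q1 \o g)%VF.
Proof.
move=> Hw [Hu [h0 [h1 [H0 H1 e0 e1 e2]]]].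
have [|s Hs sE] := extend_along HI0 d0_hom (is_homB H1 (is_hom_comp j_hom Hw)).
  move=> x /(exactP ex1)[y <-]; rewrite add_lfunE opp_lfunE -e2 !comp_lfunE.
  by rewrite subrr.
have [|g Hg gE] := factor_epi aug_epi
    (is_homB H0 (is_hom_comp i_hom (is_hom_comp q0_hom Hs))).
  move=> x /(exactP ex0)[y <-]; rewrite add_lfunE opp_lfunE !comp_lfunE sE.
  rewrite add_lfunE opp_lfunE comp_lfunE !linearB /= e1 (exact0 _ jq) linear0.
  by rewrite oppr0 subr0 subrr.
exists g => //; apply/lfunP => y; have [x <-] := epi_surj y aug_epi.
rewrite comp_lfunE gE -e0 add_lfunE opp_lfunE !comp_lfunE linearB /=.
by rewrite (exact0 _ iq) subr0.
Qed.

Let connected_act c (phi : forall n, 'End(R n)) h u :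
  is_chain_lift (dual_reg_lmul c) phi -> connected h u ->
  connected (h \o dual_reg_lmul c)%VF (u \o phi 2)%VF.
Proof.
move=> [Hphi phi0 phiS] [Hu [h0 [h1 [H0 H1 e0 e1 e2]]]].
split; first exact: is_hom_comp.
have phiSE m x : res_d R m (phi m.+1 x) = phi m (res_d R m x).
  by have /lfunP/(_ x) := phiS m; rewrite !comp_lfunE.
exists (h0 \o phi 0)%VF, (h1 \o phi 1)%VF; split=> [||x|x|x].
- exact: is_hom_comp.
- exact: is_hom_comp.
- rewrite !comp_lfunE e0; congr (h _).
  by have /lfunP/(_ x) := phi0; rewrite !comp_lfunE.
- by rewrite !comp_lfunE e1 /d0 phiSE.
- by rewrite !comp_lfunE e2 /d1 phiSE.
Qed.

Let orbit_cocycle (m : M) (f : 'Hom(R 2, reg C)) :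
  ext_cocycle f -> ext_cocycle (orbit_map m \o f)%VF.
Proof.
move=> [Hf fd]; split; first exact: is_hom_comp (is_hom_orbit m) Hf.
by rewrite -comp_lfunA fd comp_lfun0r.
Qed.

Let lmul_cocycle c (f : 'Hom(R 2, reg C)) :
  ext_cocycle f -> ext_cocycle (lmul c \o f)%VF.
Proof.
move=> [Hf fd]; split; first exact: is_hom_comp (is_hom_lmul c) Hf.
by rewrite -comp_lfunA fd comp_lfun0r.
Qed.

Let cls_cob (g : 'Hom(R 1, reg C)) : is_hom g -> cls (g \o d1)%VF = 0.
Proof.
move=> Hg; apply/(proj2 cls_class); last by exists g.
split; first exact: is_hom_comp.
apply/lfunP => x; rewrite !comp_lfunE zero_lfunE (exact0 _ ex2).
by rewrite linear0.
Qed.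

Let chain_lift c :
  exists phi : forall n, 'End(R n), is_chain_lift (dual_reg_lmul c) phi.
Proof. exact/chain_lift_ex/dual_reg_lmul_hom. Qed.

(** The homomorphisms from the cokernel of [Hom(DC, I1) -> Hom(DC, I2)] to [X];
    the right [C]-module structure comes from the left one of [DC]. *)
Definition coker_form (psi : 'Hom('Hom(dual_reg C, I2), X)) : Prop :=
  (forall g : 'Hom(dual_reg C, I1), is_hom g -> psi (q1 \o g)%VF = 0) /\
  (forall c (h : 'Hom(dual_reg C, I2)), is_hom h ->
     psi (h \o dual_reg_lmul c)%VF = ract X (psi h) c).

(** A balanced map [b] gives a form on 2-cocycles with values in [M], by
    expanding them along [F]; it is transported along [connected]. *)
Lemma coker_form_of_balanced (b : 'Hom(M, 'Hom(E, X))) : balanced b ->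
  exists2 psi, coker_form psi &
    (forall h : 'Hom(dual_reg C, I2), is_hom h -> psi h = 0) -> b = 0.
Proof.
move=> [bl br].
have [|B BE] := @lfun_ex k 'Hom(R 2, M) X
    (fun u => \sum_l b (u (r l)) (cls (F l))).
  move=> a u u'; rewrite scaler_sumr -big_split; apply: eq_bigr => l _.
  by rewrite add_lfunE scale_lfunE linearP add_lfunE scale_lfunE.
have Borbit m f : ext_cocycle f -> B (orbit_map m \o f)%VF = b m (cls f).
  move=> Hf; rewrite BE {2}(expand Hf) !linear_sum /=.
  apply: eq_bigr => l _.
  rewrite comp_lfunE orbit_mapE bl -cls_left; last exact: F_cocycle.
  by congr (b m (cls _)).
have Bcob (w : 'Hom(R 1, M)) : is_hom w -> B (w \o d1)%VF = 0.
  move=> Hw.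
  have [m [y [g [Hg yg]]]] := projective_dual_basis (res_projective R 1).
  have -> : (w \o d1)%VF = \sum_l (orbit_map (w (y l)) \o (g l \o d1))%VF.
    apply/lfunP => x; rewrite comp_lfunE sum_lfunE {1}(yg (d1 x)) linear_sum.
    by apply: eq_bigr => l _; rewrite /= Hw !comp_lfunE orbit_mapE.
  rewrite linear_sum big1 //= => l _; rewrite Borbit ?cls_cob ?linear0 //.
  split; first exact: is_hom_comp.
  apply/lfunP => x; rewrite !comp_lfunE zero_lfunE (exact0 _ ex2).
  by rewrite linear0.
have Bact c phi u : is_chain_lift (dual_reg_lmul c) phi -> ext_cocycle u ->
    B (u \o phi 2)%VF = ract X (B u) c.
  move=> Hphi Hu; rewrite {1}(expand Hu) (_ : (_ \o _)%VF =
      \sum_l (orbit_map (u (r l)) \o (F l \o phi 2))%VF); last first.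
    apply/lfunP => x; rewrite comp_lfunE !sum_lfunE.
    by apply: eq_bigr => l _; rewrite !comp_lfunE.
  rewrite linear_sum BE ract_suml; apply: eq_bigr => l _ /=.
  have [Hphi_hom _ phiS] := Hphi.
  rewrite Borbit ?(cls_right Hphi) ?br //.
  have [HF Fd] := F_cocycle l; split; first exact: is_hom_comp.
  by rewrite -comp_lfunA -(phiS 2) comp_lfunA Fd comp_lfun0l.
have [H HP] := hom_space (dual_reg C) I2.
have [|||psi psiE] := @linear_relation k _ X H
    (fun h x => exists2 u, connected h u & B u = x).
- by move=> h /HP/connected_right[u hu]; exists (B u), u.
- move=> a h h' x x' [u hu <-] [u' hu' <-]; exists (a *: u + u').
    exact: connected_lin.
  by rewrite linearP.
- move=> x [u hu <-].
  have [||w Hw ->] := @connected_coboundary 0 u; first exact: is_hom0.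
    by rewrite comp_lfun0r.
  exact: Bcob.
have psiB h u : is_hom h -> connected h u -> psi h = B u.
  by move=> /HP Hh hu; apply: psiE => //; exists u.
exists psi; first split.
- move=> g Hg; have Hqg := is_hom_comp q1_hom Hg.
  have [u hu] := connected_right Hqg; rewrite (psiB _ _ Hqg hu).
  by have [w Hw ->] := connected_coboundary Hg hu; apply: Bcob.
- move=> c h Hh; have [u hu] := connected_right Hh.
  have [phi Hphi] := chain_lift c.
  rewrite (psiB _ _ Hh hu) -(Bact c phi) //; last exact: connected_cocycle hu.
  apply: psiB; last exact: connected_act.
  exact: is_hom_comp Hh (dual_reg_lmul_hom c).
- move=> psi0; apply/lfunP => m; apply/lfunP => e; rewrite !zero_lfunE.
  have [f Hf <-] := proj1 cls_class e.
  have [h [hu Hh]] := connected_left (orbit_cocycle m Hf).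
  by rewrite -Borbit // -(psiB _ _ Hh hu) psi0.
Qed.

(** The form [psi] is transported to the cocycles with values in [M], and then
    evaluated on products of elements of [M] with cocycles with values in [C].
    *)
Lemma balanced_of_coker_form psi : coker_form psi ->
  exists2 b : 'Hom(M, 'Hom(E, X)), balanced b &
    b = 0 -> forall h : 'Hom(dual_reg C, I2), is_hom h -> psi h = 0.
Proof.
move=> [psi_ker psi_act].
have cocycle_lin (Y : rmod C) a (u u' : 'Hom(R 2, Y)) :
    ext_cocycle u -> ext_cocycle u' -> ext_cocycle (a *: u + u').
  move=> [Hu ud] [Hu' ud']; split; first exact: is_hom_lin.
  by rewrite comp_lfunDl -comp_lfunZl ud ud' scaler0 addr0.
have cocycle0 (Y : rmod C) : ext_cocycle (0 : 'Hom(R 2, Y)).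
  by split; [exact: is_hom0 | rewrite comp_lfun0l].
have [|U UP] := subspace_ex (cocycle0 M); first exact: cocycle_lin.
have [|V VP] := subspace_ex (cocycle0 (reg C)); first exact: cocycle_lin.
have [|||eta etaE] := @linear_relation k _ X U
    (fun u x => exists2 h, connected h u /\ is_hom h & psi h = x).
- by move=> u /UP/connected_left[h hu]; exists (psi h), h.
- move=> a u u' x x' [h [hu Hh] <-] [h' [hu' Hh'] <-]; exists (a *: h + h').
    by split; [apply: connected_lin | apply: is_hom_lin].
  by rewrite linearP.
- move=> x [h [hu Hh] <-].
  have [||g Hg ->] := @connected_trivial h 0; first exact: is_hom0.
    by rewrite comp_lfun0l.
  exact: psi_ker.
have etaP h u : is_hom h -> connected h u -> eta u = psi h.
  move=> Hh hu; apply: etaE; last by exists h.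
  by apply/UP/(connected_cocycle hu).
have eta_cob (w : 'Hom(R 1, M)) : is_hom w -> eta (w \o d1)%VF = 0.
  move=> Hw; have [|h [hu Hh]] := @connected_left (w \o d1)%VF.
    split; first exact: is_hom_comp.
    apply/lfunP => x; rewrite !comp_lfunE zero_lfunE (exact0 _ ex2).
    by rewrite linear0.
  rewrite (etaP _ _ Hh hu); have [g Hg ->] := connected_trivial Hw hu.
  exact: psi_ker.
have [|s sP] := @linear_section k _ _ V cls.
  by move=> e; have [f /VP Hf fe] := proj1 cls_class e; exists f.
have s_cocycle e : ext_cocycle (s e) by apply/VP; case: (sP e).
have sK e : cls (s e) = e by case: (sP e).
have [||b bE] := @bilinear_ex k M E X (fun m e => eta (orbit_map m \o s e)%VF).
- by move=> e a m m'; rewrite orbit_map_lin comp_lfunDl -comp_lfunZl linearP.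
- by move=> m a e e'; rewrite linearP comp_lfunDr -comp_lfunZr linearP.
have bcls m f : ext_cocycle f -> b m (cls f) = eta (orbit_map m \o f)%VF.
  move=> Hf; rewrite bE; apply/eqP; rewrite -subr_eq0 -linearB /=; apply/eqP.
  have Hd : ext_cocycle (- f + s (cls f)).
    by rewrite -scaleN1r; apply: cocycle_lin.
  have [|g Hg gE] := proj1 (proj2 cls_class _ Hd).
    by rewrite linearD linearN /= sK addNr.
  rewrite -(eta_cob (orbit_map m \o g)%VF); last first.
    exact: is_hom_comp (is_hom_orbit m) Hg.
  by rewrite -comp_lfunA -gE comp_lfunDr comp_lfunNr addrC.
exists b; first split.
- move=> m c e; rewrite -[in RHS](sK e) -cls_left // bE.
  rewrite (bcls _ (lmul c \o s e)%VF); last exact: lmul_cocycle.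
  congr (eta _); apply/lfunP => x.
  by rewrite !comp_lfunE !orbit_mapE -ractM.
- move=> m e c; have [phi Hphi] := chain_lift c.
  have [Hphi_hom _ phiS] := Hphi.
  rewrite -[in LHS](sK e) -(cls_right Hphi) // bcls; last first.
    have [Hs sd] := s_cocycle e; split; first exact: is_hom_comp.
    by rewrite -comp_lfunA -(phiS 2) comp_lfunA sd comp_lfun0l.
  have [h [hu Hh]] := connected_left (orbit_cocycle m (s_cocycle e)).
  rewrite bE (etaP _ _ Hh hu) -psi_act // comp_lfunA; apply: etaP.
    exact: is_hom_comp Hh (dual_reg_lmul_hom c).
  exact: connected_act.
- move=> b0 h Hh; have [u hu] := connected_right Hh.
  rewrite -(etaP _ _ Hh hu) (expand (connected_cocycle hu)) linear_sum big1 //.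
  by move=> l _; rewrite /= -bcls // b0 !zero_lfunE.
Qed.

End ConnectingMap.

Section InverseTranslate.
Variables (k : fieldType) (C : falgType k) (X : rmod C).
Variables (P1 P0 : rmod C^c) (p1 : 'Hom(P1, P0)) (T : rmod C^c^c).
Variable cls : 'Hom('Hom(P1, reg C^c), T).
Hypothesis p1_hom : is_hom p1.
Hypothesis cls_surj :
  forall y : T, exists2 f : 'Hom(P1, reg C^c), is_hom f & cls f = y.
Hypothesis cls_ker : forall f : 'Hom(P1, reg C^c), is_hom f ->
  (cls f = 0 <-> exists2 g : 'Hom(P0, reg C^c), is_hom g & f = (g \o p1)%VF).
Hypothesis cls_act : forall (a : C^c) (f : 'Hom(P1, reg C^c)), is_hom f ->
  cls (amull a \o f)%VF = ract T (cls f) a.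
Variable q : 'Hom(codual P0, codual P1).
Hypothesis qE : forall (phi : 'Hom(P0, k^o)) x,
  (q phi : 'Hom(P1, k^o)) x = phi (p1 x).

(** With it the presentation of the inverse translate by [Hom(P1, C)] and
    [Hom(P0, C)] becomes the one by [Hom(DC, DP1)] and [Hom(DC, DP0)]. *)
Lemma transposition (P : rmod C^c) :
  exists theta : 'Hom('Hom(P, reg C^c), 'Hom(dual_reg C, codual P)),
  [/\ forall (f : 'Hom(P, reg C^c)) (phi : 'Hom(C, k^o)) x,
        (theta f phi : 'Hom(P, k^o)) x = phi (f x),
      forall f, is_hom f -> is_hom (theta f),
      lker theta = 0%VS
    & forall h : 'Hom(dual_reg C, codual P), is_hom h ->
        exists2 f, is_hom f & theta f = h].
Proof.
have [||theta thetaE] :=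
  @bilinear_ex k 'Hom(P, reg C^c) 'Hom(C, k^o) 'Hom(P, k^o)
    (fun f phi => (phi \o (f : 'Hom(P, C)))%VF).
- by move=> phi a f f'; rewrite comp_lfunDr -comp_lfunZr.
- by move=> f a phi phi'; rewrite comp_lfunDl -comp_lfunZl.
have thE (f : 'Hom(P, reg C^c)) (phi : 'Hom(C, k^o)) x :
    (theta f phi : 'Hom(P, k^o)) x = phi (f x).
  by rewrite thetaE comp_lfunE.
exists theta; split=> // [f Hf phi a | | h Hh].
- apply/lfunP => x; rewrite thE codual_actE thE Hf.
  by rewrite comp_lfunE lfunE.
- apply/eqP/lker0P => f f' /lfunP ff'; apply/lfunP => x; apply/eqP.
  rewrite -subr_eq0; apply/eqP/form_sep => phi.
  by rewrite linearB /= -!thE ff' subrr.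
have [f fE] := transposed (h : 'Hom('Hom(C, k^o), 'Hom(P, k^o))).
exists f; last by apply/lfunP => phi; apply/lfunP => x; rewrite thE fE.
move=> x a; apply/eqP; rewrite -subr_eq0; apply/eqP/form_sep => phi.
rewrite linearB /= fE -codual_actE -Hh -fE.
by rewrite comp_lfunE lfunE subrr.
Qed.

Lemma coker_form_of_hom (f : 'Hom(rmod_cc T, X)) : is_hom f ->
  exists2 psi : 'Hom('Hom(dual_reg C, codual P1), X), coker_form q psi &
    (forall h : 'Hom(dual_reg C, codual P1), is_hom h -> psi h = 0) -> f = 0.
Proof.
move=> Hf; have [th1 [th1E th1_hom th1_inj th1_surj]] := transposition P1.
have [th0 [th0E th0_hom _ th0_surj]] := transposition P0.
have th1K : cancel th1 th1^-1%VF by apply: lker0_lfunK; rewrite th1_inj.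
pose psi : 'Hom('Hom(dual_reg C, codual P1), X) := (f \o (cls \o th1^-1))%VF.
have psiE g : psi (th1 g) = f (cls g) by rewrite !comp_lfunE th1K.
exists psi; first split.
- move=> g' /th0_surj[g Hg <-].
  have -> : (q \o th0 g)%VF = th1 (g \o p1)%VF.
    apply/lfunP => phi; apply/lfunP => x.
    by rewrite comp_lfunE qE th0E th1E comp_lfunE.
  rewrite psiE (proj2 (cls_ker _)) ?linear0 //; first exact: is_hom_comp.
  by exists g.
- move=> c h /th1_surj[g Hg <-].
  have -> : (th1 g \o dual_reg_lmul c)%VF = th1 (lmul (c : C^c) \o g)%VF.
    apply/lfunP => phi; apply/lfunP => x.
    rewrite comp_lfunE !th1E comp_lfunE lmulE lfunE /=.
    by rewrite comp_lfunE lfunE.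
  by rewrite !psiE cls_act // Hf.
- move=> psi0; apply/lfunP => y; rewrite zero_lfunE.
  have [g Hg <-] := cls_surj y.
  by rewrite -psiE psi0 //; apply: th1_hom.
Qed.

Lemma hom_of_coker_form (psi : 'Hom('Hom(dual_reg C, codual P1), X)) :
  coker_form q psi ->
  exists2 f : 'Hom(rmod_cc T, X), is_hom f &
    f = 0 -> forall h : 'Hom(dual_reg C, codual P1), is_hom h -> psi h = 0.
Proof.
move=> [psi_ker psi_act].
have [th1 [th1E th1_hom _ th1_surj]] := transposition P1.
have [th0 [th0E th0_hom _ th0_surj]] := transposition P0.
have [H HP] := hom_space P1 (reg C^c).
have [|s sP] := @linear_section k _ _ H cls.
  by move=> t; have [g /HP Hg gt] := cls_surj t; exists g.
have sH t : is_hom (s t) by apply/HP; case: (sP t).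
have sK t : cls (s t) = t by case: (sP t).
pose f : 'Hom(rmod_cc T, X) := (psi \o (th1 \o s))%VF.
have fcls g : is_hom g -> f (cls g) = psi (th1 g).
  move=> Hg; apply/eqP; rewrite -subr_eq0 !comp_lfunE -!linearB /=; apply/eqP.
  have [|w Hw ->] := proj1 (cls_ker (is_homB (sH (cls g)) Hg)).
    by rewrite linearB /= sK subrr.
  have -> : th1 (w \o p1)%VF = (q \o th0 w)%VF.
    apply/lfunP => phi; apply/lfunP => x.
    by rewrite comp_lfunE qE th0E th1E comp_lfunE.
  by apply/psi_ker/th0_hom.
exists f => [t a | f0 h /th1_surj[g Hg <-]]; last first.
  by rewrite -fcls // f0 zero_lfunE.
have -> : ract (rmod_cc T) t a = cls (lmul (a : C^c) \o s t)%VF.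
  by rewrite -[t in LHS]sK /= -cls_act.
rewrite fcls; last exact: is_hom_comp (is_hom_lmul _) (sH t).
have -> : th1 (lmul (a : C^c) \o s t)%VF = (th1 (s t) \o dual_reg_lmul a)%VF.
  apply/lfunP => phi; apply/lfunP => x.
  rewrite comp_lfunE !th1E comp_lfunE lmulE lfunE /=.
  by rewrite comp_lfunE lfunE.
rewrite psi_act; last exact: th1_hom.
by rewrite /f !comp_lfunE.
Qed.

End InverseTranslate.

Section TensorProduct.
Variables (k : fieldType) (C : falgType k) (E : bimod C).
Hypotheses (tiltedC : tilted C) (extE : is_ext2_bimod E).
Variables (M I N : rmod C) (i : 'Hom(M, I)) (p : 'Hom(I, N)).
Hypotheses (HI : injective_mod I) (se : short_exact i p).
Variables (P1 P0 : rmod C^c) (p1 : 'Hom(P1, P0)) (p0 : 'Hom(P0, dual N)).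
Hypothesis minp : minimal_proj_presentation p1 p0.
Variables (T : rmod C^c^c) (cls : 'Hom('Hom(P1, reg C^c), T)).
Hypothesis cls_surj :
  forall y : T, exists2 f : 'Hom(P1, reg C^c), is_hom f & cls f = y.
Hypothesis cls_ker : forall f : 'Hom(P1, reg C^c), is_hom f ->
  (cls f = 0 <-> exists2 g : 'Hom(P0, reg C^c), is_hom g & f = (g \o p1)%VF).
Hypothesis cls_act : forall (a : C^c) (f : 'Hom(P1, reg C^c)), is_hom f ->
  cls (amull a \o f)%VF = ract T (cls f) a.

(** [rmod_cc T] is [tau^{-1} N] with [N] the first cosyzygy of [M]; both it and
    [M (x) E] are [Ext^2(DC, M)]. *)
Lemma hom_zero_balanced (X : rmod C) :
  hom_zero (rmod_cc T) X <-> balanced_zero E M X.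
Proof.
have [[HP0 p0_epi _] [HP1 p1_hom p10 sup]] := minp.
have gldim (Q1 Q0 K : rmod C) (f : 'Hom(Q1, Q0)) (l : 'Hom(K, Q1)) :
    projective Q1 -> projective Q0 -> is_hom f -> mod_mono l ->
    limg l = lker f -> projective K.
  exact: tilted_kernel_projective.
have [j [q [j_mono jq q_hom qE]]] := codual_resolution p1_hom p0_epi p10.
have HI0 := codual_injective HP0.
have [L [l [r [l_mono r_epi lq lr]]]] := image_factor q_hom.
have seL : short_exact j r.
  split=> //; rewrite jq; apply/vspaceP => x; rewrite !memv_ker -lr.
  by apply/eqP/eqP => [/(mono_ker l_mono) // | ->]; rewrite linear0.
have HL := second_cosyzygy_injective gldim HI se HI0 seL.
have p1_mono := presentation_mono p1_hom qE HL l_mono lq sup.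
have q_epi : mod_epi q.
  apply: epiI => // phi; exists ((phi : 'Hom(P1, k^o)) \o p1^-1)%VF.
  apply/lfunP => x; rewrite qE comp_lfunE lker0_lfunK //.
  by case: p1_mono => _ ->.
have seq : short_exact j q by [].
have [R [clsE [clsE_class clsE_left clsE_right]]] := extE.
have [n [s [F [F_cocycle expand]]]] := cocycle_basis R gldim.
split=> [zero b Hb | bz f Hf].
- have [psi Hpsi psi0] := coker_form_of_balanced clsE_class clsE_left clsE_right
    F_cocycle expand se seq HI HI0 Hb.
  have [f Hf f0] := hom_of_coker_form cls_surj cls_ker cls_act qE Hpsi.
  exact/psi0/f0/zero.
- have [psi Hpsi psi0] :=
    coker_form_of_hom p1_hom cls_surj cls_ker cls_act qE Hf.
  have [b Hb b0] := balanced_of_coker_form clsE_class clsE_left clsE_right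
    F_cocycle expand se seq HI HI0 Hpsi.
  exact/psi0/b0/bz.
Qed.

End TensorProduct.

Theorem corollary1p2 (k : closedFieldType) (C : falgType k) (E : bimod C)
    (M : rmod C) :
  tilted C -> is_ext2_bimod E ->
  indecomposable M -> tau_rigid M ->
  (tau_rigid (inflate E M) <->
   forall N Y X : rmod C,
     is_cosyzygy M N -> is_tau_inv N Y -> in_Gen M X -> hom_zero Y X).
Proof.
move=> tiltedC extE _ rigM.
apply: (iff_trans (tau_rigid_inflate E rigM)); split=> [bz N Y X | H X MX].
- move=> [I [i [p [[HI _ _] se]]]].
  move=> [T [P1 [P0 [p1 [p0 [cls [minp surj ker act]]]]]]] [u [umono uepi]] MX.
  have zero : hom_zero (rmod_cc T) X.
    exact/(hom_zero_balanced tiltedC extE HI se minp surj ker act)/bz.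
  move=> f Hf; have [|g Hg gE] := factor_epi uepi Hf.
    by move=> x /(mono_ker umono) ->; rewrite linear0.
  by apply/lfunP => x; rewrite -gE (zero _ Hg) !zero_lfunE.
- have [I [i ienv]] := injective_envelope_ex M.
  have [HI Hi _] := ienv; have i_hom : is_hom i by case: Hi.
  have [N [p [Hp pi]]] := quotient_ex (is_submod_img i_hom).
  have se : short_exact i p by split.
  have [P1 [P0 [p1 [p0 minp]]]] := minimal_presentation_ex (dual N).
  have [_ [_ p1_hom _ _]] := minp.
  have [T [cls [surj ker act]]] := transpose_coker_ex p1_hom.
  apply/(hom_zero_balanced tiltedC extE HI se minp surj ker act).
  apply: (H N) => //; first by exists I, i, p.
  exists T; last exact: mod_iso_refl.
  by exists P1, P0, p1, p0, cls.
Qed.
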